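(* Let $\mathcal F:\mathcal M_1^N\to\mathcal M_1^N$ be the self-consistent transfer operator associated with twice continuously differentiable maps $f_i:\mathbb T\to\mathbb T$ and interaction functions $h_{ij}:\mathbb T\times\mathbb T\to\mathbb R$, $i,j=1,\dots,N$, and let $G:\mathbb T^N\to\mathbb T^N$ and $g_i:\mathbb T^N\to\mathbb R$ be the associated map and functions (all defined in the context). Assume that there are $\lambda\in(0,1)$ and $n_0\in\mathbb N$ such that 1) $G$ has an invariant set $X\subset\mathbb T^N$ which is uniformly attracting, i.e. there is an open set $U\supset X$ with $G(U)\subset U$ and $$d(G^{n_0}(\boldsymbol x),X)\le\lambda\, d(\boldsymbol x,X)\qquad\text{for all }\boldsymbol x\in U;$$ 2) $\left|\prod_{j=0}^{n_0-1}g_i(G^{j}\boldsymbol x)\right|\le\lambda<1$ for every $\boldsymbol x\in X$ and every $i=1,\dots,N$. Then there are $R>0$, $\epsilon>0$ and $\Lambda\in(0,1)$ such that if $\boldsymbol\mu=(\mu_1,\dots,\mu_N)\in\mathcal M_1^N$ satisfies $$|\operatorname{supp}\boldsymbol\mu|_\infty<\epsilon\quad\text{and}\quad \operatorname{supp}\boldsymbol\mu\subset B_R(X),$$ then $$d_W(\mathcal F^n\boldsymbol\mu,\mathcal S_X)\le\mathcal O(\Lambda^n),$$ i.e. there is a constant $C>0$ with $d_W(\mathcal F^n\boldsymbol\mu,\mathcal S_X)\le C\Lambda^n$ for all $n\in\mathbb N$.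
   Context: $\mathbb T=\mathbb R/\mathbb Z$ is the circle; $N\in\mathbb N$; $d$ denotes the distance on $\mathbb T^N$ and $d(\boldsymbol x,X)=\inf_{\boldsymbol y\in X}d(\boldsymbol x,\boldsymbol y)$; $B_R(X)=\{\boldsymbol y\in\mathbb T^N:\inf_{\boldsymbol x\in X}d(\boldsymbol y,\boldsymbol x)<R\}$. A set $X$ is invariant under $G$ if $G(X)\subset X$. $\mathcal M_1$ is the set of Borel probability measures on $\mathbb T$. For a measurable map $T:\mathbb T\to\mathbb T$, its transfer operator is the push-forward $T_*\mu=\mu\circ T^{-1}$. Self-consistent operator: for $\boldsymbol\mu=(\mu_1,\dots,\mu_N)\in\mathcal M_1^N$ put $$F_{\boldsymbol\mu,i}(x)=f_i\Big(x+\sum_{j=1}^N\int_{\mathbb T}h_{ij}(x,y)\,d\mu_j(y)\Big),\qquad \mathcal F\boldsymbol\mu=\big(F_{\boldsymbol\mu,1*}\mu_1,\dots,F_{\boldsymbol\mu,N*}\mu_N\big).$$ The map $G$ is defined by $G(\boldsymbol x)=\boldsymbol x'$ where $\mathcal F(\delta_{x_1},\dots,\delta_{x_N})=(\delta_{x_1'},\dots,\delta_{x_N'})$, that is, $(G(\boldsymbol x))_i=f_i\big(x_i+\sum_j h_{ij}(x_i,x_j)\big)$. The functions $g_i$ are $$g_i(\boldsymbol x)=(F_{(\delta_{x_1},\dots,\delta_{x_N}),i})'(x_i)=\partial_x\Big[f_i\Big(x+\sum_j h_{ij}(x,x_j)\Big)\Big]\Big|_{x=x_i}.$$ Wasserstein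 distance: for $\mu,\nu\in\mathcal M_1$, $d_W(\mu,\nu)=\sup_{\varphi}\int\varphi\,d(\mu-\nu)$ over $\varphi:\mathbb T\to\mathbb R$ with Lipschitz constant at most $1$; for $\boldsymbol\mu,\boldsymbol\nu\in\mathcal M_1^N$, $d_W(\boldsymbol\mu,\boldsymbol\nu)=\max_i d_W(\mu_i,\nu_i)$; the distance to a set is the infimum of the distances to its elements. Supports: $\operatorname{supp}\boldsymbol\mu=\operatorname{supp}\mu_1\times\dots\times\operatorname{supp}\mu_N$ (topological supports), $|\operatorname{supp}\mu_i|=\inf\{|I|: I\text{ an arc with }\operatorname{supp}\mu_i\subset I\}$ where $|I|$ is arc length, and $|\operatorname{supp}\boldsymbol\mu|_\infty=\max_i|\operatorname{supp}\mu_i|$. $\mathcal S_X=\{\boldsymbol\mu\in\mathcal M_1^N:\ \exists\boldsymbol x\in X\text{ with }\mu_i=\delta_{x_i}\ \forall i=1,\dots,N\}$.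
   Formalization: The open set U is required to contain the closure of X instead of only X (the same for closed X); as stated the claim fails for non-closed X, e.g. an open arc X = U whose boundary point is a repelling fixed point of G. *)

(* Defs.v *)
From HB Require Import structures.
From mathcomp Require Import all_boot all_order all_algebra.
From mathcomp Require Import archimedean generic_quotient ring_quotient.
From mathcomp Require Import all_classical all_reals all_analysis.
From mathcomp Require Import lra zify.

Set Implicit Arguments.
Unset Strict Implicit.
Unset Printing Implicit Defensive.

Import Order.TTheory GRing.Theory Num.Theory.
Import numFieldNormedType.Exports.

Local Open Scope classical_set_scope.
Local Open Scope ring_scope.

Section Circle.
Variable R : realType.

Definition int_zmod : zmodClosed R :=
  GRing.ZmodClosed.clone R (@Num.int_num_subdef R) _.

Definition circle := Quotient.quot int_zmod.

HB.instance Definition _ := GRing.Zmodule.on circle.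
HB.instance Definition _ := EqQuotient.on circle.

Definition tocircle (t : R) : circle := \pi_circle%qT t.

(* The representative of [z] in [-1/2, 1/2[, hence the one of least absolute
   value. *)
Definition srep (z : circle) : R :=
  let r := repr z in r - (Num.floor (r + 2^-1))%:~R.

Lemma tocircleB t s : tocircle (t - s) = tocircle t - tocircle s.
Proof. by rewrite /tocircle; exact: (raddfB (\pi_circle%qT : R -> circle)). Qed.

Lemma tocircleD t s : tocircle (t + s) = tocircle t + tocircle s.
Proof. by rewrite /tocircle; exact: (raddfD (\pi_circle%qT : R -> circle)). Qed.

Lemma tocircle_eq t s : tocircle t = tocircle s <-> t - s \is a Num.int.
Proof.
have -> : (t - s \is a Num.int) = (t == s %[mod circle])%qT.
  exact: (Quotient.idealrBE int_zmod t s).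
by split=> [ts|/eqP //]; exact/eqP.
Qed.

Lemma srepK z : tocircle (srep z) = z.
Proof.
rewrite -[RHS](@reprK _ circle z); apply/tocircle_eq.
by rewrite /srep addrC addKr rpredN intr_int.
Qed.

Lemma srep_bound z : - 2^-1 <= srep z < 2^-1.
Proof.
rewrite /srep; set r := repr z.
have := floor_itv (r + 2^-1); rewrite intrD; lra.
Qed.

Lemma srep_min t : `|srep (tocircle t)| <= `|t|.
Proof.
have := srep_bound (tocircle t); have := srepK (tocircle t).
set s := srep _ => /tocircle_eq/intrP[m stm] /andP[s1 s2].
have -> : t = s - m%:~R by rewrite -stm opprB addrC subrK.
rewrite ler_norml.
case: (ltrgt0P m) => [m0|m0|->]; last by rewrite subr0 -ler_norml.
  have m1 : 1 <= m%:~R :> R by rewrite -[1]/(1%:~R) ler_int.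
  have := ler_norm (- (s - m%:~R)); rewrite normrN.
  by set n := `|_|; lra.
have m1 : m%:~R <= -1 :> R by rewrite -[-1]/((-1)%:~R) ler_int; lia.
have := ler_norm (s - m%:~R).
by set n := `|_|; lra.
Qed.

Definition circle_dist (x y : circle) : R := `|srep (x - y)|.

Lemma srep0 : srep 0 = 0.
Proof.
apply/eqP; rewrite -normr_le0; have := srep_min 0.
by rewrite normr0 (_ : tocircle 0 = 0) // -(subrr 0) tocircleB subrr.
Qed.

Lemma circle_distxx x : circle_dist x x = 0.
Proof. by rewrite /circle_dist subrr srep0 normr0. Qed.

Lemma circle_dist_positivity x y : circle_dist x y = 0 -> x = y.
Proof.
move=> /normr0_eq0 h; apply/eqP; rewrite -subr_eq0 -[_ - _]srepK h.
by rewrite -srep0 srepK.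
Qed.

Lemma circle_dist_le x y : circle_dist x y <= circle_dist y x.
Proof.
rewrite /circle_dist -[X in `|srep X|]opprB -[X in - X]srepK -sub0r.
have -> : 0 = tocircle 0 by rewrite -[LHS](subrr (tocircle 0)) -tocircleB subrr.
by rewrite -tocircleB (le_trans (srep_min _)) // sub0r normrN.
Qed.

Lemma circle_dist_sym x y : circle_dist x y = circle_dist y x.
Proof. by apply/eqP; rewrite eq_le !circle_dist_le. Qed.

Lemma circle_dist_triangle y x z :
  circle_dist x z <= circle_dist x y + circle_dist y z.
Proof.
rewrite /circle_dist (le_trans _ (ler_normD _ _)) //.
have -> : x - z = tocircle (srep (x - y) + srep (y - z)).
  by rewrite tocircleD !srepK addrA subrK.
exact: srep_min.
Qed.

HB.instance Definition _ := isPointed.Build circle 0.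
HB.instance Definition _ := isMetric.Build R circle
  circle_distxx circle_dist_positivity circle_dist_sym circle_dist_triangle.

HB.instance Definition _ := @isMeasurable.Build
  (sigma_display (@open circle)) circle <<s @open circle >>
  (@sigma_algebra0 _ setT (@open circle)) (@sigma_algebraC _ (@open circle))
  (@sigma_algebra_bigcup _ setT (@open circle)).

End Circle.

Arguments tocircle {R} t.
Arguments srep {R} z.

Section Smooth.
Context {R : realType}.

(* Iterated directional derivatives in all directions; on the
   finite-dimensional spaces [R] and [R * R] used below, this is the usual
   notion of a [k] times continuously differentiable function. *)
Fixpoint is_Ck (k : nat) (V : normedModType R) (F : V -> R) : Prop :=
  if k is k'.+1 then
    forall v, (forall p, derivable F p v) /\ is_Ck k' ('D_v F)
  else continuous F.

Definition circle_C2 (f : circle R -> circle R) : Prop :=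
  exists F : R -> R,
    is_Ck 2 F /\ forall t, tocircle (F t) = f (tocircle t).

Definition circle2_C2 (h : circle R -> circle R -> R) : Prop :=
  is_Ck 2 (fun p : R * R => h (tocircle p.1) (tocircle p.2)).

(* [srep] turns the increment of [f], an element of the circle near 0, into a
   real number. *)
Definition circle_deriv (f : circle R -> circle R) (x : circle R) : R :=
  derive1 (fun t : R => srep (f (x + tocircle t) - f x)) 0.

End Smooth.

Section Torus.
Context {R : realType} {N : nat}.

Definition torus := 'rV[circle R]_N.

(* The topology carried by ['rV[circle R]_N] is the one of this distance. *)
Definition torus_dist (x y : torus) : R :=
  \big[Num.max/0]_(i < N) mdist (x 0 i) (y 0 i).

(* Extended-real valued, so that the distance to the empty set is [+oo]. *)
Definition torus_dist_set (x : torus) (X : set torus) : \bar R :=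
  ereal_inf [set (torus_dist x y)%:E | y in X].

Definition torus_nbh (r : R) (X : set torus) : set torus :=
  [set x | (torus_dist_set x X < r%:E)%E].

End Torus.

Arguments torus R N : clear implicits.

Section Measures.
Context {R : realType}.

Local Notation M1 := (probability (circle R) R).

(* The push-forward of a probability measure along a measurable map. The value
   along a map which is not measurable is irrelevant. *)
Definition transfer (T : circle R -> circle R) (mu : M1) : M1 :=
  match pselect (measurable_fun [set: circle R] T) with
  | left mT => distribution mu (mfun_Sub (mem_set mT))
  | right _ => mu
  end.

Definition wasserstein (mu nu : M1) : \bar R :=
  ereal_sup [set (\int[mu]_(x in setT) phi x - \int[nu]_(x in setT) phi x)%:E
            | phi in [set phi : circle R -> R |
                       forall x y, `|phi x - phi y| <= mdist x y]].

Definition msupport (mu : M1) : set (circle R) :=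
  [set x | forall U, open U -> U x -> (0 < mu U)%E].

Definition arc (a l : R) : set (circle R) := tocircle @` `[a, a + l]%classic.

Definition arc_hull_length (A : set (circle R)) : R :=
  inf [set l : R | 0 <= l <= 1 /\ exists a, A `<=` arc a l].

Context {N : nat}.
Implicit Types mu nu : 'I_N -> M1.

Definition wassersteinN mu nu : \bar R :=
  \big[maxe/0%E]_(i < N) wasserstein (mu i) (nu i).

Definition wasserstein_set mu (S : set ('I_N -> M1)) : \bar R :=
  ereal_inf [set wassersteinN mu nu | nu in S].

Definition msupportN mu : set (torus R N) :=
  [set x | forall i, msupport (mu i) (x 0 i)].

Definition supp_size mu : R :=
  \big[Num.max/0]_(i < N) arc_hull_length (msupport (mu i)).

(* Measures are functions on all subsets; only their values on measurable sets
   are relevant. *)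
Definition dirac_tuples (X : set (torus R N)) : set ('I_N -> M1) :=
  [set mu | exists2 x, X x &
    forall i A, measurable A -> mu i A = \d_(x 0 i) A].

End Measures.

Section SelfConsistent.
Context {R : realType} {N : nat}.
Variable f : 'I_N -> circle R -> circle R.
Variable h : 'I_N -> 'I_N -> circle R -> circle R -> R.

Local Notation M1 := (probability (circle R) R).

Definition sc_map (mu : 'I_N -> M1) (i : 'I_N) (x : circle R) : circle R :=
  f i (x + tocircle (\sum_(j < N) \int[mu j]_(y in setT) h i j x y)).

Definition sc_transfer (mu : 'I_N -> M1) : 'I_N -> M1 :=
  fun i => transfer (sc_map mu i) (mu i).

(* [sc_map] at a tuple of Dirac masses. *)
Definition point_map (x : torus R N) (i : 'I_N) (z : circle R) : circle R :=
  f i (z + tocircle (\sum_(j < N) h i j z (x 0 j))).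

Definition G_map (x : torus R N) : torus R N :=
  \row_i point_map x i (x 0 i).

Definition g_fun (i : 'I_N) (x : torus R N) : R :=
  circle_deriv (point_map x i) (x 0 i).

End SelfConsistent.

(* Main.v *)
Require Import Defs.
From HB Require Import structures.
From mathcomp Require Import all_boot all_order all_algebra.
From mathcomp Require Import finmap.
From mathcomp Require Import all_classical all_reals all_analysis.
From mathcomp Require Import ring lra zify.

Import Order.TTheory GRing.Theory Num.Theory.
Import numFieldNormedType.Exports.

Local Open Scope classical_set_scope.
Local Open Scope ring_scope.

(** A tuple of measures carried by balls of radius [l] around the coordinates
    of [x] is pushed by one step into balls of radius [L * l] around [G x]
    ([shadow_near]); if the balls also lie within [rho] of a point [z], the
    radius in direction [i] is multiplied by at most [|g_i z| + O(rho)]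
    ([step_contraction]).  Following an orbit in [X] near [x] for [n0] steps,
    the radius contracts by a factor close to [lambda], while the distance from
    the centre to [X] becomes at most [lambda * d(x, X) + L ^ n0 * l].  Hence
    [d(x, X) + Q * l], with [Q] large, is a Lyapunov function decreasing
    geometrically, and it dominates the Wasserstein distance to the Dirac
    masses on [X]. *)

Set Implicit Arguments.
Unset Strict Implicit.
Unset Printing Implicit Defensive.

(** The contraction hypothesis speaks of the [g_i] along orbits in X only, while the measures need
    not sit on X. So contraction is never deduced at the centre x itself: over a block of [n0] steps
    two families of balls are carried, balls about the orbit of some z in X, whose radius is
    controlled only up to the harmless factor [L ^ k], and balls of initial radius l about the
    images of x under the maps that the measures themselves generate. Points lying in both families
    are moved by the same map, with a Lipschitz constant read off at the orbit of z. The resulting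
    recursion is triangular: the new radius depends on l alone, the new distance to X on both
    quantities. This is why a weighted sum can decrease. *)

(** * The circle *)

Section CircleGeometry.
Context {R : realType}.
Implicit Types (x y z : circle R) (t s : R).

Lemma tocircle0 : tocircle 0 = 0 :> circle R.
Proof. by rewrite -(subrr 0) tocircleB subrr. Qed.

Lemma srep_small t : `|t| < 2^-1 -> srep (tocircle t) = t.
Proof.
have /andP[s1 s2] := srep_bound (tocircle t).
have := srepK (tocircle t); set s := srep _ in s1 s2 * => /tocircle_eq/intrP[m stm].
rewrite ltr_norml => /andP[t1 t2].
suff m0 : m = 0 by apply/eqP; rewrite -subr_eq0 stm m0.
have : (m%:~R : R) < 1%:~R by rewrite -stm; lra.
have : ((-1)%:~R : R) < m%:~R by rewrite -stm mulrNz; lra.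
by rewrite !ltr_int; lia.
Qed.

Lemma mdist_addr z x y : mdist (x + z) (y + z) = mdist x y.
Proof. by rewrite [LHS]/(`|_|) opprD addrACA subrr addr0. Qed.

Lemma mdist_tocircleD x t s :
  mdist (x + tocircle t) (x + tocircle s) <= `|t - s|.
Proof.
by rewrite [leLHS]/(`|_|) opprD addrACA subrr add0r -tocircleB srep_min.
Qed.

Lemma mdist_tocircle t s : mdist (tocircle t) (tocircle s : circle R) <= `|t - s|.
Proof. by rewrite -[tocircle t]add0r -[tocircle s]add0r mdist_tocircleD. Qed.

Lemma mdist_tocircleD_small x t s : `|t - s| < 2^-1 ->
  mdist (x + tocircle t) (x + tocircle s) = `|t - s|.
Proof.
by move=> ts; rewrite [LHS]/(`|_|) opprD addrACA subrr add0r -tocircleB srep_small.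
Qed.

Lemma addr_srepB x y : x + tocircle (srep (y - x)) = y.
Proof. by rewrite srepK addrC subrK. Qed.

Lemma norm_srepB x y : `|srep (y - x)| = mdist x y.
Proof. by rewrite metric_sym. Qed.

Lemma norm_srep x : `|srep x| <= 2^-1.
Proof.
by have /andP[? ?] := srep_bound x; rewrite ler_norml; apply/andP; split; lra.
Qed.

Lemma mdist_circle_le x y : mdist x y <= 2^-1.
Proof. exact: norm_srep. Qed.

Lemma lipschitz_continuous_metric (S T : metricType R) (K : R) (g : S -> T) :
  (forall p q, mdist (g p) (g q) <= K * mdist p q) -> continuous g.
Proof.
move=> gK p; apply/cvg_ballP => e e0.
have K0 : 0 < `|K| + 1 by rewrite ltr_wpDl.
have := nbhsx_ballx p _ (divr_gt0 e0 K0).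
apply: filterS => q; rewrite !ballEmdist /= ltr_pdivlMr// => xy.
rewrite (le_lt_trans (gK _ _))// (le_lt_trans _ xy)// mulrC ler_wpM2l ?mdist_ge0//.
by rewrite (le_trans (ler_norm _))// lerDl.
Qed.

Lemma lipschitz_continuous_real (S : metricType R) (K : R) (g : S -> R) :
  (forall p q, `|g p - g q| <= K * mdist p q) -> continuous g.
Proof.
move=> gK; apply: (@lipschitz_continuous_metric S R^o K) => p q.
by have := gK p q; rewrite distrC.
Qed.

Lemma tocircle_continuous : continuous (@tocircle R).
Proof.
apply: (@lipschitz_continuous_metric R^o _ 1) => t s.
by rewrite mul1r (le_trans (mdist_tocircle _ _))// distrC.
Qed.

Lemma circle_compact : compact [set: circle R].
Proof.
have -> : [set: circle R] = tocircle @` `[- 2^-1, 2^-1]%classic.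
  apply/seteqP; split => // x _; exists (srep x); last exact: srepK.
  by have := norm_srep x; rewrite /= in_itv/= ler_norml.
apply: continuous_compact; last exact: segment_compact.
exact/continuous_subspaceT/tocircle_continuous.
Qed.

Lemma circle_continuous_measurable (g : circle R -> circle R) :
  continuous g -> measurable_fun setT g.
Proof.
move=> /continuousP cg; apply: (measurability (@open (circle R))) => //.
move=> _ [U oU <-]; rewrite setTI; apply: sub_sigma_algebra; exact: cg.
Qed.

Lemma circle_continuous_measurable_real (g : circle R -> R) :
  continuous g -> measurable_fun setT g.
Proof.
move=> /continuousP cg.
apply: (measurability _ (measurable_realfun.RGenOpens.measurableE R)).
move=> _ [_ [a [b ->]] <-]; rewrite setTI; apply: sub_sigma_algebra.
by apply: cg; exact: interval_open.
Qed.

Lemma mdist_continuous x : continuous (mdist x : circle R -> R).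
Proof.
apply: (@lipschitz_continuous_real _ 1) => y z; rewrite mul1r.
have := metric_triangle x y z; have := metric_triangle x z y.
by rewrite (metric_sym z y) => ? ?; rewrite ler_norml; apply/andP; split; lra.
Qed.

(** Closed balls allow the radius 0, which describes a Dirac mass. *)
Definition cball x (r : R) : set (circle R) := [set y | mdist x y <= r].

Lemma measurable_cball x r : measurable (cball x r).
Proof.
have mf : measurable_fun setT (mdist x : circle R -> R).
  apply: circle_continuous_measurable_real; exact: mdist_continuous.
rewrite (_ : cball x r = setT `&` mdist x @^-1` `]-oo, r]%classic).
  exact: mf.
by rewrite setTI; apply/seteqP; split => y; rewrite /cball/= in_itv.
Qed.

End CircleGeometry.

(** * Mean value estimates *)

Section Calculus.
Context {R : realType}.
Implicit Types (a b c r t s B : R) (g dg : R -> R).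

(** By the mean value theorem [g a - g b] is a value of [dg] times [a - b]. Taking [c = 0] yields a
    Lipschitz bound, taking for [c] the derivative at the centre yields a linearisation. *)
Lemma MVT_lipschitz g dg r c B a b :
    (forall t, `|t| <= r -> is_derive t 1 g (dg t) /\ `|dg t - c| <= B) ->
  `|a| <= r -> `|b| <= r -> `|g a - g b - c * (a - b)| <= B * `|a - b|.
Proof.
move=> gd; wlog ab : a b / a <= b => [hw|].
  move=> ar br; have [/hw|/ltW/hw] := leP a b; first exact.
  move=> /(_ br ar); rewrite -normrN (distrC b a).
  by rewrite (_ : - (_ - _ - _) = g a - g b - c * (a - b)) //; ring.
rewrite !ler_norml => /andP[ar1 ar2] /andP[br1 br2].
have gdab t : t \in `[a, b]%R -> is_derive t 1 g (dg t) /\ `|dg t - c| <= B.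
  rewrite in_itv/= => /andP[t1 t2]; apply: gd.
  by rewrite ler_norml; apply/andP; split; lra.
have [t||x xab gE] := @MVT_segment _ g dg a b ab.
- by move=> /subset_itv_oo_cc/gdab[].
- by apply: derivable_within_continuous => t /gdab[[]].
have [_ gB] := gdab _ xab.
rewrite (_ : g a - g b - c * (a - b) = (dg x - c) * (a - b)).
  by rewrite -ler_norml normrM ler_wpM2r.
by rewrite mulrBl; congr (_ - _); rewrite -[a - b]opprB mulrN -gE opprB.
Qed.

Lemma is_derive_shift g a t c :
  is_derive (a + t) 1 g c -> is_derive t 1 (fun u => g (a + u)) c.
Proof.
have E : (fun u : R => u^-1 *: (g (u *: 1 + (a + t)) - g (a + t))) =
    (fun u : R => u^-1 *: (g (a + (u *: 1 + t)) - g (a + t))).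
  by apply/funext => u; rewrite addrCA.
by case; rewrite /derivable /derive E => ? ?; split.
Qed.

Lemma box_bounded (G : R * R -> R) : continuous G ->
  exists2 B, 0 <= B & forall t s, `|t| <= 1 -> `|s| <= 1 -> `|G (t, s)| <= B.
Proof.
move=> cG.
have cK : compact (`[-1, 1]%classic `*` `[-1, 1]%classic : set (R * R)).
  by apply: compact_setX; exact: segment_compact.
have /compact_bounded[M [_ /(_ (M + 1))]] : compact (G @` (`[-1, 1] `*` `[-1, 1])).
  apply: continuous_compact => //; exact/continuous_subspaceT.
rewrite ltrDl ltr01 => /(_ isT) GM; exists `|M + 1| => // t s t1 s1.
rewrite (le_trans _ (ler_norm _))//; apply: GM; exists (t, s) => //=.
by rewrite !in_itv/= -!ler_norml.
Qed.

Lemma segment_bounded g : continuous g ->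
  exists2 B, 0 <= B & forall t, `|t| <= 1 -> `|g t| <= B.
Proof.
move=> cg; have [|B B0 gB] := @box_bounded (g \o fst).
  by move=> p; apply: continuous_comp; [exact: cvg_fst|exact: cg].
by exists B => // t t1; apply: (gB t 0); rewrite ?normr0.
Qed.

(** Both derivatives are limits of one and the same difference quotient. *)
Lemma is_derive_slice1 (G : R * R -> R) t s : derivable G (t, s) (1, 0) ->
  is_derive t 1 (fun u => G (u, s)) ('D_(1, 0) G (t, s)).
Proof.
have E : (fun u : R => u^-1 *: (G (u *: (1, 0) + (t, s)) - G (t, s))) =
    (fun u : R => u^-1 *: (G (u *: 1 + t, s) - G (t, s))).
  apply/funext => u.
  have -> : u *: (1, 0) + (t, s) = (u *: 1 + t, u *: 0 + s) by [].
  by rewrite scaler0 add0r.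
move=> dG; split; last by rewrite /derive -E.
by rewrite /derivable -E.
Qed.

Lemma is_derive_slice2 (G : R * R -> R) t s : derivable G (t, s) (0, 1) ->
  is_derive s 1 (fun u => G (t, u)) ('D_(0, 1) G (t, s)).
Proof.
have E : (fun u : R => u^-1 *: (G (u *: (0, 1) + (t, s)) - G (t, s))) =
    (fun u : R => u^-1 *: (G (t, u *: 1 + s) - G (t, s))).
  apply/funext => u.
  have -> : u *: (0, 1) + (t, s) = (u *: 0 + t, u *: 1 + s) by [].
  by rewrite scaler0 add0r.
move=> dG; split; last by rewrite /derive -E.
by rewrite /derivable -E.
Qed.

(** Changing one coordinate at a time reduces the claim to the mean value estimate on slices. *)
Lemma box_lipschitz (G : R * R -> R) B :
    (forall p, derivable G p (1, 0)) -> (forall p, derivable G p (0, 1)) ->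
    (forall t s, `|t| <= 1 -> `|s| <= 1 ->
       `|'D_(1, 0) G (t, s)| <= B /\ `|'D_(0, 1) G (t, s)| <= B) ->
  forall t s t' s', `|t| <= 1 -> `|s| <= 1 -> `|t'| <= 1 -> `|s'| <= 1 ->
    `|G (t, s) - G (t', s')| <= B * (`|t - t'| + `|s - s'|).
Proof.
move=> d1 d2 GB t s t' s' t1 s1 t'1 s'1.
have B1 := @MVT_lipschitz (fun u => G (u, s)) (fun u => 'D_(1, 0) G (u, s))
  1 0 B t t' _ t1 t'1.
have B2 := @MVT_lipschitz (fun u => G (t', u)) (fun u => 'D_(0, 1) G (t', u))
  1 0 B s s' _ s1 s'1.
rewrite (_ : _ - _ = (G (t, s) - G (t', s)) + (G (t', s) - G (t', s')));
  last by ring.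
rewrite mulrDr (le_trans (ler_normD _ _))// lerD//.
  move: B1; rewrite mul0r subr0; apply => u u1; rewrite subr0; split.
    exact: is_derive_slice1.
  by have [] := GB u s u1 s1.
move: B2; rewrite mul0r subr0; apply => u u1; rewrite subr0; split.
  exact: is_derive_slice2.
by have [] := GB t' u t'1 u1.
Qed.

Lemma C1_box_lipschitz (G : R * R -> R) : is_Ck 1 G ->
  exists2 B, 0 <= B & forall t s t' s',
    `|t| <= 1 -> `|s| <= 1 -> `|t'| <= 1 -> `|s'| <= 1 ->
    `|G (t, s)| <= B /\
    `|G (t, s) - G (t', s')| <= B * (`|t - t'| + `|s - s'|).
Proof.
move=> GC; have [d1 c1] := GC (1, 0); have [d2 c2] := GC (0, 1).
have [B1 B10 G1] := box_bounded c1; have [B2 B20 G2] := box_bounded c2.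
have GB t s : `|t| <= 1 -> `|s| <= 1 ->
    `|'D_(1, 0) G (t, s)| <= B1 + B2 /\ `|'D_(0, 1) G (t, s)| <= B1 + B2.
  by move=> t1 s1; have := G1 _ _ t1 s1; have := G2 _ _ t1 s1; split; lra.
have GL := box_lipschitz d1 d2 GB.
(* The value at the origin plus [2 * (B1 + B2)] bounds the values, as [|t| + |s| <= 2] on the box;
   it also exceeds the Lipschitz constant [B1 + B2]. *)
exists (`|G (0, 0)| + 2 * (B1 + B2)) => [|t s t' s' t1 s1 t'1 s'1].
  by rewrite addr_ge0// mulr_ge0// addr_ge0.
split.
  have := GL t s 0 0 t1 s1; rewrite !normr0 !subr0 => /(_ ler01 ler01) {}GL.
  have : (B1 + B2) * (`|t| + `|s|) <= (B1 + B2) * 2 by rewrite ler_wpM2l; lra.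
  have := ler_normD (G (t, s) - G (0, 0)) (G (0, 0)); rewrite subrK; lra.
apply: (le_trans (GL _ _ _ _ t1 s1 t'1 s'1)); rewrite ler_wpM2r ?addr_ge0//.
have := normr_ge0 (G (0, 0)); lra.
Qed.

End Calculus.

(* [srep] unfolds to a difference, which additive rewrite patterns would
   otherwise match. *)
#[local] Opaque srep.

(** * Uniform estimates for maps and interactions of class C2 *)

Section CircleC2.
Context {R : realType}.
Implicit Types (x y : circle R) (t s rho : R).

Lemma norm_srep1 x : `|srep x| <= 1.
Proof. by have := norm_srep x; lra. Qed.

(** A representative plus an increment of size at most 1/2 stays in [[-1, 1]], so bounds on this
    interval serve the whole circle; hence the condition [rho <= 2^-1] below. *)
Lemma srep_shift1 x t : `|t| <= 2^-1 -> `|srep x + t| <= 1.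
Proof. by move=> ?; have := ler_normD (srep x) t; have := norm_srep x; lra. Qed.

(** The last clause uses the slope at [(x, y)] for every [y'] near [y], so that it can be integrated
    over a measure concentrated near [y]. *)
Definition interaction_bounds (K : R) (h h1 : circle R -> circle R -> R) : Prop :=
  [/\ forall x y, `|h1 x y| <= K,
    forall x y x' y', `|h x y - h x' y'| <= K * (mdist x x' + mdist y y'),
    forall x y, is_derive (0 : R) 1 (fun t => h (x + tocircle t) y) (h1 x y) &
    forall x y y' rho t s, rho <= 2^-1 -> mdist y y' <= rho ->
      `|t| <= rho -> `|s| <= rho ->
      `|h (x + tocircle t) y' - h (x + tocircle s) y' - h1 x y * (t - s)|
        <= K * rho * `|t - s|].

(** The last clause is the chain rule in the shape that [circle_deriv] takes for [g_fun]. *)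
Definition map_bounds (K : R) (f : circle R -> circle R)
    (f1 : circle R -> R) : Prop :=
  [/\ forall x, `|f1 x| <= K,
    forall x y, mdist (f x) (f y) <= K * mdist x y,
    forall x rho u v, rho <= 2^-1 -> `|u| <= rho -> `|v| <= rho ->
      mdist (f (x + tocircle u)) (f (x + tocircle v))
        <= (`|f1 x| + K * rho) * `|u - v| &
    forall x (u : R -> R) c, u 0 = 0 -> is_derive (0 : R) 1 u c ->
      derive1 (fun t => srep (f (x + tocircle (u t)) - f x)) 0 = f1 x * c].

Lemma interaction_boundsW (K K' : R) h h1 : K <= K' ->
  interaction_bounds K h h1 -> interaction_bounds K' h h1.
Proof.
move=> KK' [b1 b2 b3 b4]; split=> //.
- by move=> x y; apply: le_trans KK'; exact: b1.
- move=> x y x' y'; rewrite (le_trans (b2 _ _ _ _))// ler_wpM2r//.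
  by rewrite addr_ge0// mdist_ge0.
- move=> x y y' rho t s rho2 yy' tr sr.
  rewrite (le_trans (b4 _ _ _ _ _ _ rho2 yy' tr sr))// ler_wpM2r// ler_wpM2r//.
  exact: le_trans (normr_ge0 _) tr.
Qed.

Lemma map_boundsW (K K' : R) f f1 : K <= K' ->
  map_bounds K f f1 -> map_bounds K' f f1.
Proof.
move=> KK' [b1 b2 b3 b4]; split=> //.
- by move=> x; apply: le_trans KK'; exact: b1.
- by move=> x y; rewrite (le_trans (b2 _ _))// ler_wpM2r// mdist_ge0.
- move=> x rho u v rho2 ur vr.
  rewrite (le_trans (b3 _ _ _ _ rho2 ur vr))// ler_wpM2r// lerD2l ler_wpM2r//.
  exact: le_trans (normr_ge0 _) ur.
Qed.

(** All estimates are read off the periodic lift [H] on the square [[-1, 1]^2], where compactness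
    bounds the derivatives up to order two. *)
Lemma circle2_C2_bounds (h : circle R -> circle R -> R) : circle2_C2 h ->
  exists K h1, 0 <= K /\ interaction_bounds K h h1.
Proof.
rewrite /circle2_C2; set H := (fun p : R * R => _) => HC2.
have [d1 C1] := HC2 (1, 0); have [d2 C2] := HC2 (0, 1).
have [B1 B10 H1] := C1_box_lipschitz C1.
have [B2 B20 H2] := C1_box_lipschitz C2.
have HL : forall t s t' s', `|t| <= 1 -> `|s| <= 1 -> `|t'| <= 1 -> `|s'| <= 1 ->
    `|H (t, s) - H (t', s')| <= (B1 + B2) * (`|t - t'| + `|s - s'|).
  apply: box_lipschitz => // t s t1 s1.
  have [h1 _] := H1 t s t s t1 s1 t1 s1; have [h2 _] := H2 t s t s t1 s1 t1 s1.
  by split; lra.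
have HE x y t s : h (x + tocircle t) (y + tocircle s) = H (srep x + t, srep y + s).
  by rewrite /H /= (tocircleD (srep x)) (tocircleD (srep y)) !srepK.
have HE0 x y t : h (x + tocircle t) y = H (srep x + t, srep y).
  by rewrite /H /= (tocircleD (srep x)) !srepK.
pose h1 x y := 'D_(1, 0) H (srep x, srep y).
(* The factor 2 comes from the last clause, where the increment and [mdist y y'] are both at most
   [rho]. *)
exists (2 * (B1 + B2)), h1; split; first by rewrite mulr_ge0// addr_ge0.
split.
- move=> x y; rewrite /h1.
  have [+ _] := H1 _ _ _ _ (norm_srep1 x) (norm_srep1 y)
    (norm_srep1 x) (norm_srep1 y).
  lra.
- move=> x y x' y'.
  have := HE x y (srep (x' - x)) (srep (y' - y)); rewrite !addr_srepB => ->.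
  have := HE x y 0 0; rewrite !tocircle0 !addr0 => ->.
  have := HL (srep x) (srep y) _ _ (norm_srep1 _) (norm_srep1 _)
    (srep_shift1 x (norm_srep (x' - x))) (srep_shift1 y (norm_srep (y' - y))).
  have cancel (a b : R) : a - (a + b) = - b by rewrite opprD addrA subrr add0r.
  rewrite !cancel !normrN !norm_srepB => /le_trans; apply.
  by rewrite ler_wpM2r ?addr_ge0 ?mdist_ge0//; lra.
- move=> x y; under eq_fun do rewrite HE0.
  apply: (@is_derive_shift _ (fun t => H (t, srep y))); rewrite addr0.
  exact: is_derive_slice1.
- move=> x y y' rho t s rho2 yy' tr sr.
  have := HE x y t (srep (y' - y)); have := HE x y s (srep (y' - y)).
  rewrite !addr_srepB => -> ->; set s' := srep y + _.
  have s'1 : `|s'| <= 1 by apply: srep_shift1; exact: norm_srep.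
  apply: (@MVT_lipschitz _ (fun t => H (srep x + t, s'))
    (fun t => 'D_(1, 0) H (srep x + t, s')) rho) => // u ur; split.
    apply: (@is_derive_shift _ (fun t => H (t, s'))); exact: is_derive_slice1.
  have ux1 : `|srep x + u| <= 1 by apply: srep_shift1; lra.
  have [_ /le_trans] := H1 _ _ _ _ ux1 s'1 (norm_srep1 x) (norm_srep1 y); apply.
  rewrite addrAC subrr add0r /s' addrAC subrr add0r norm_srepB.
  have rho0 : 0 <= rho by exact: le_trans (normr_ge0 _) ur.
  have : B1 * (`|u| + mdist y y') <= B1 * (2 * rho) by rewrite ler_wpM2l//; lra.
  have : 0 <= B2 * rho by rewrite mulr_ge0.
  nra.
Qed.

Lemma circle_C2_bounds (f : circle R -> circle R) : circle_C2 f ->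
  exists K f1, 0 <= K /\ map_bounds K f f1.
Proof.
move=> [F [FC2 fF]].
have [d1 C1] := FC2 1; have {C1} [d2 c2] := C1 1.
have [B B0 F2B] := segment_bounded c2.
have F1E t : is_derive t 1 F ('D_1 F t) by exact: DeriveDef.
have F2E t : is_derive t 1 ('D_1 F) ('D_1 ('D_1 F) t) by exact: DeriveDef.
have F1L t s : `|t| <= 1 -> `|s| <= 1 -> `|'D_1 F t - 'D_1 F s| <= B * `|t - s|.
  have := @MVT_lipschitz R ('D_1 F) ('D_1 ('D_1 F)) 1 0 B t s.
  by rewrite mul0r subr0; apply => u u1; rewrite subr0; split=> //; exact: F2B.
pose M := `|'D_1 F 0| + B.
have F1M t : `|t| <= 1 -> `|'D_1 F t| <= M.
  move=> t1; have := F1L t 0 t1; rewrite normr0 subr0 => /(_ ler01) h.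
  have := ler_normD ('D_1 F t - 'D_1 F 0) ('D_1 F 0); rewrite subrK /M.
  have : B * `|t| <= B * 1 by rewrite ler_wpM2l.
  lra.
have fE x u : f (x + tocircle u) = tocircle (F (srep x + u)).
  by rewrite fF (tocircleD (srep x)) srepK.
have M0 : 0 <= M by rewrite addr_ge0.
have BM : B <= M by rewrite lerDr.
have Fd x (u : R) : is_derive u 1 (fun u => F (srep x + u)) ('D_1 F (srep x + u)).
  exact: is_derive_shift.
have key x rho u v : rho <= 2^-1 -> `|u| <= rho -> `|v| <= rho ->
    mdist (f (x + tocircle u)) (f (x + tocircle v))
      <= (`|'D_1 F (srep x)| + B * rho) * `|u - v|.
  move=> rho2 ur vr; rewrite !fE (le_trans (mdist_tocircle _ _))//.
  have := @MVT_lipschitz R (fun t => F (srep x + t)) (fun t => 'D_1 F (srep x + t))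
    rho 0 (`|'D_1 F (srep x)| + B * rho) u v.
  rewrite mul0r subr0; apply => // t tr; rewrite subr0; split=> //.
  have tx1 : `|srep x + t| <= 1 by apply: srep_shift1; lra.
  have := F1L _ _ tx1 (norm_srep1 x); rewrite [srep x + t]addrC addrK => h.
  have := ler_normD ('D_1 F (t + srep x) - 'D_1 F (srep x)) ('D_1 F (srep x)).
  rewrite subrK.
  have : B * `|t| <= B * rho by rewrite ler_wpM2l.
  lra.
(* The factor 2 covers the Lipschitz clause, which is [key] with [rho = 2^-1] and has constant at
   most [M + B / 2]. *)
exists (2 * M), (fun x => 'D_1 F (srep x)); split; first by rewrite mulr_ge0.
split.
- by move=> x; have := F1M _ (norm_srep1 x); lra.
- move=> x y; have := key x 2^-1 0 (srep (y - x)) (lexx _) _ (norm_srep _).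
  rewrite tocircle0 addr0 addr_srepB sub0r normrN norm_srepB normr0.
  move=> /(_ _)/le_trans.
  apply; first by rewrite invr_ge0.
  by rewrite ler_wpM2r ?mdist_ge0//; have := F1M _ (norm_srep1 x); lra.
- move=> x rho u v rho2 ur vr; rewrite (le_trans (key _ _ _ _ rho2 ur vr))//.
  have rho0 : 0 <= rho by exact: le_trans (normr_ge0 _) ur.
  by rewrite ler_wpM2r// lerD2l ler_wpM2r//; lra.
- move=> x u c u0 uc.
  pose g t := F (srep x + u t) - F (srep x).
  have gd : is_derive (0 : R) 1 g ('D_1 F (srep x) * c).
    rewrite -[_ * c]subr0; apply: is_deriveB.
    apply: (@is_derive1_comp _ (fun v => F (srep x + v)) u) => //.
    by have := Fd x (u 0); rewrite [in 'D_1 F _]u0 addr0.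
  have g0 : g 0 = 0 by rewrite /g u0 addr0 subrr.
  have cg : {for 0, continuous g}.
    by apply: differentiable_continuous; apply/derivable1_diffP; case: gd.
  (* Near 0 the lifted increment [g] is below 1/2 in absolute value, where [srep] returns it
     unchanged; so both functions have the same derivative. *)
  rewrite derive1E -(@derive_val _ _ _ _ _ _ _ gd); apply: near_eq_derive => //.
  have /cvgrPdist_lt/(_ 2^-1) := cg; rewrite g0 invr_gt0 => /(_ (ltr0n _ _)).
  apply: filterS => t; rewrite sub0r normrN => gt.
  rewrite fE -[in f x](addr0 x) -tocircle0 fE addr0 -tocircleB srep_small//.
Qed.

End CircleC2.

(** * Measures on the circle *)

(** The complement of [B] is negligible, so the integral may be restricted to [B]. *)
Lemma norm_Rintegral_le_full d (T : measurableType d) (R : realType)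
    (P : probability T R) (B : set T) (g : T -> R) (e : R) :
    P.-integrable setT (EFin \o g) -> measurable B -> P B = 1%E ->
    (forall x, B x -> `|g x| <= e) ->
  `|\int[P]_(x in setT) g x| <= e.
Proof.
move=> ig mB PB ge.
have PB0 : P (~` B) = 0%E by rewrite probability_setC// PB subee.
have PBoo : (P B < +oo)%E by rewrite PB ltry.
have mBC : measurable (~` B) by exact: measurableC.
have igB : P.-integrable B (EFin \o g) by exact: integrableS ig.
have -> : \int[P]_(x in setT) g x = \int[P]_(x in B) g x.
  by rewrite /Rintegral (negligible_integral mBC _ ig)// setDE setTI setCK.
rewrite (le_trans (le_normr_Rintegral mB igB))//.
have <- : \int[P]_(x in B) e = e by rewrite Rintegral_cst//= PB mulr1.
apply: le_Rintegral => //; first exact: integrable_norm igB.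
by apply: measurable_bounded_integrable => //; exact: bounded_cst.
Qed.

Lemma probability_full_sub d (T : measurableType d) (R : realType)
    (P : probability T R) (A B : set T) :
  measurable A -> measurable B -> A `<=` B -> P A = 1%E -> P B = 1%E.
Proof.
move=> mA mB AB PA; apply/eqP; rewrite eq_le probability_le1//= -PA.
by rewrite le_measure// inE.
Qed.

Lemma probability_full_setI d (T : measurableType d) (R : realType)
    (P : probability T R) (A B : set T) :
  measurable A -> measurable B -> P A = 1%E -> P B = 1%E -> P (A `&` B) = 1%E.
Proof.
move=> mA mB PA PB.
have [mA' mB'] : measurable (~` A) /\ measurable (~` B).
  by split; exact: measurableC.
have [PA0 PB0] : P (~` A) = 0%E /\ P (~` B) = 0%E.
  by rewrite !probability_setC// PA PB subee.
rewrite -[A `&` B]setCK setCI probability_setC; last exact: measurableU.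
have -> : P (~` A `|` ~` B) = 0%E := etrans (measureU0 mA' mB' PB0) PA0.
exact: sube0.
Qed.

Lemma Rintegral_cst_probability d (T : measurableType d) (R : realType)
    (P : probability T R) (c : R) :
  \int[P]_(x in setT) c = c.
Proof.
rewrite Rintegral_cst// -[RHS]mulr1; congr (_ * _).
exact: (congr1 fine (probability_setT P)).
Qed.

Section CircleMeasures.
Context {R : realType}.
Implicit Types (x y : circle R) (mu : probability (circle R) R).

Lemma lipschitz_integrable mu (phi : circle R -> R) (K : R) :
  (forall x y, `|phi x - phi y| <= K * mdist x y) ->
  mu.-integrable setT (EFin \o phi).
Proof.
move=> phiK; have muoo : (mu setT < +oo)%E by rewrite probability_setT ltry.
apply: measurable_bounded_integrable => //.
  apply: circle_continuous_measurable_real; exact: (lipschitz_continuous_real phiK).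
exists (`|phi 0| + `|K|); split => // M MK x _ /=.
have := phiK x 0; have := ler_normD (phi x - phi 0) (phi 0); rewrite subrK.
have : K * mdist x 0 <= `|K| * 1.
  apply: (@le_trans _ _ (`|K| * mdist x 0)).
    by rewrite ler_wpM2r ?mdist_ge0// ler_norm.
  by rewrite ler_wpM2l//; have := mdist_circle_le x 0; lra.
lra.
Qed.

(** Lets a pointwise linearisation of the interaction on a ball, with [c] the linear term, pass to
    its integrals. *)
Lemma Rintegral_sub_le mu (B : set (circle R)) (phi psi : circle R -> R)
    (K c e : R) : measurable B -> mu B = 1%E ->
    (forall x y, `|phi x - phi y| <= K * mdist x y) ->
    (forall x y, `|psi x - psi y| <= K * mdist x y) ->
    (forall x, B x -> `|phi x - psi x - c| <= e) ->
  `|\int[mu]_(x in setT) phi x - \int[mu]_(x in setT) psi x - c| <= e.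
Proof.
move=> mB muB phiK psiK Be.
have iphi := lipschitz_integrable mu phiK.
have ipsi := lipschitz_integrable mu psiK.
have ic : mu.-integrable setT (EFin \o (fun=> c) : circle R -> \bar R).
  by apply: (@lipschitz_integrable _ _ 0) => x y; rewrite subrr normr0 mul0r.
have ipp : mu.-integrable setT (EFin \o (fun x => phi x - psi x)).
  exact: (integrableB measurableT iphi ipsi).
have ippc : mu.-integrable setT (EFin \o (fun x => phi x - psi x - c)).
  exact: (integrableB measurableT ipp ic).
have {1}-> : c = \int[mu]_(x in setT) c.
  by rewrite Rintegral_cst_probability.
rewrite -RintegralB// -RintegralB//.
exact: norm_Rintegral_le_full ippc mB muB Be.
Qed.

Lemma Rintegral_cst_le mu (B : set (circle R)) (phi : circle R -> R)
    (K c e : R) : measurable B -> mu B = 1%E ->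
    (forall x y, `|phi x - phi y| <= K * mdist x y) ->
    (forall x, B x -> `|phi x - c| <= e) ->
  `|\int[mu]_(x in setT) phi x - c| <= e.
Proof.
move=> mB muB phiK Be.
have K0 x y : 0 <= K * mdist x y by exact: le_trans (normr_ge0 _) (phiK x y).
have zK x y : `|(fun=> 0 : R) x - (fun=> 0) y| <= K * mdist x y.
  by rewrite /= subrr normr0.
have Be0 x : B x -> `|phi x - (fun=> 0) x - c| <= e by move=> /Be; rewrite /= subr0.
have := Rintegral_sub_le mB muB phiK zK Be0.
by rewrite Rintegral_cst_probability subr0.
Qed.

(** Both integrals are compared with [phi x]; the Dirac mass is the case of radius 0. *)
Lemma wasserstein_dirac_le mu x (rho : R) : mu (cball x rho) = 1%E ->
  (wasserstein mu (dirac x : probability _ R) <= rho%:E)%E.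
Proof.
move=> mux; apply: ge_ereal_sup => _ [phi /= phi1 <-]; rewrite lee_fin.
have phi1' u v : `|phi u - phi v| <= 1 * mdist u v by rewrite mul1r phi1.
have phix (r : R) y : cball x r y -> `|phi y - phi x| <= r.
  by rewrite /cball/= metric_sym; exact: le_trans (phi1 y x).
have dx : \d_x (cball x 0) = 1%E :> \bar R.
  by rewrite diracE mem_set// /cball/= mdistxx.
have := Rintegral_cst_le (measurable_cball x rho) mux phi1' (@phix rho).
have := Rintegral_cst_le (measurable_cball x 0) dx phi1' (@phix 0).
rewrite !ler_norml => /andP[? ?] /andP[? ?]; lra.
Qed.

Lemma transfer_cball mu (T : circle R -> circle R) (A : set (circle R)) y (r : R) :
    continuous T -> measurable A -> (forall z, A z -> mdist y (T z) <= r) ->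
    mu A = 1%E ->
  transfer T mu (cball y r) = 1%E.
Proof.
(* A continuous map is measurable, which excludes the default branch of [transfer]. *)
move=> cT mA AT muA; rewrite /transfer; case: pselect => [mT|/(_ _)]; last first.
  by case; exact: circle_continuous_measurable.
have mTA : measurable (T @^-1` cball y r).
  by rewrite -[X in measurable X]setTI; apply: mT => //; exact: measurable_cball.
exact: (@probability_full_sub _ _ _ mu A _ mA mTA AT muA).
Qed.

Lemma open_measurable_circle (U : set (circle R)) : open U -> measurable U.
Proof. exact: sub_sigma_algebra. Qed.

(** Each point of [K] has an open null neighbourhood, and finitely many of them cover [K]. *)
Lemma compact_disjoint_msupport mu (K : set (circle R)) :
  compact K -> measurable K -> (forall x, K x -> ~ msupport mu x) -> mu K = 0%E.
Proof.
move=> cK mK Ksupp; pose D := [set U : set (circle R) | open U /\ mu U = 0%E].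
have [D' D'D KD'] : finite_subset_cover D (@id (set (circle R))) K.
  rewrite compact_cover in cK; apply: cK => [U []//|x Kx].
  have /existsNP[U /not_implyP[oU /not_implyP[Ux /negP]]] := Ksupp x Kx.
  by rewrite -leNgt measure_le0 => /eqP U0; exists U.
apply/eqP; rewrite -measure_le0.
have -> : 0%E = \sum_(U \in [set` D']) mu U.
  by rewrite fsbig1// => U /= /D'D/set_mem[].
apply: content_sub_fsum => //= U /D'D/set_mem[oU _].
exact: open_measurable_circle.
Qed.

(** Otherwise the compact circle itself would be null. *)
Lemma msupport_nonempty mu : msupport mu !=set0.
Proof.
apply/set0P/negP => /eqP s0.
have := @compact_disjoint_msupport mu setT circle_compact measurableT.
rewrite s0 probability_setT => /(_ (fun _ _ => id)) /eqP.
by rewrite onee_eq0.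
Qed.

Lemma arc_mdist (a l : R) x y : Defs.arc a l x -> Defs.arc a l y -> mdist x y <= l.
Proof.
move=> [t /= + <-] [s /= + <-]; rewrite !in_itv/= => /andP[? ?] /andP[? ?].
by rewrite (le_trans (mdist_tocircle _ _))// ler_norml; apply/andP; split; lra.
Qed.

(** An arc shorter than [e] contains the support, so the points at distance at least [e] from [x]
    form a compact set that misses the support. *)
Lemma msupport_cball mu x (e : R) : arc_hull_length (msupport mu) < e ->
  msupport mu x -> mu (cball x e) = 1%E.
Proof.
move=> le sx.
have [l [_ [a sa]] lt_le] : exists2 l : R,
    0 <= l <= 1 /\ exists a, msupport mu `<=` Defs.arc a l & l < e.
  (* The set of lengths has a member, 1; the infimum of an empty set would be the default value
     0. *)
  apply: inf_lt le; exists 1; split; first by rewrite ler01 lexx.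
  exists (- 2^-1) => y _; exists (srep y); last exact: srepK.
  by have /andP[? ?] := srep_bound y; rewrite /= in_itv/=; apply/andP; split; lra.
pose K := mdist x @^-1` `[e, +oo[%classic.
have clK : closed K.
  have /continuous_closedP := @mdist_continuous R x; apply; exact: rray_closed.
have mK : measurable K.
  rewrite -[K]setCK; apply: measurableC; apply: open_measurable_circle.
  exact: closed_openC.
have K0 : mu K = 0%E.
  apply: compact_disjoint_msupport => //.
    by apply: (subclosed_compact clK) circle_compact _.
  move=> y; rewrite /K/= in_itv/= andbT => ey sy.
  have := arc_mdist (sa _ sx) (sa _ sy); lra.
apply/eqP; rewrite eq_le probability_le1 /=; last exact: measurable_cball.
have <- : mu (~` K) = 1%E by rewrite probability_setC// K0 sube0.
rewrite le_measure// ?inE; [exact: measurableC|exact: measurable_cball|].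
by move=> y; rewrite /K/= in_itv/= andbT => /negP; rewrite -ltNge => /ltW.
Qed.

End CircleMeasures.

(** * The torus *)

Section TorusGeometry.
Context {R : realType} {N : nat}.
Implicit Types (x y z : torus R N) (X U : set (torus R N)) (r e : R).

Lemma mdist_le_torus_dist x y i : mdist (x 0 i) (y 0 i) <= torus_dist x y.
Proof. exact: (le_bigmax _ (fun i => mdist (x 0 i) (y 0 i))). Qed.

Lemma torus_dist_le x y r : 0 <= r ->
  (forall i, mdist (x 0 i) (y 0 i) <= r) -> torus_dist x y <= r.
Proof. by move=> r0 xy; apply: bigmax_le => // i _; exact: xy. Qed.

Lemma torus_dist_ge0 x y : 0 <= torus_dist x y.
Proof. exact: bigmax_ge_id. Qed.

Lemma torus_dist_sym x y : torus_dist x y = torus_dist y x.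
Proof. by apply: eq_bigr => i _; rewrite metric_sym. Qed.

Lemma torus_dist_triangle x y z :
  torus_dist x z <= torus_dist x y + torus_dist y z.
Proof.
apply: torus_dist_le => [|i]; first by rewrite addr_ge0// torus_dist_ge0.
by rewrite (le_trans (metric_triangle _ (y 0 i) _))// lerD// mdist_le_torus_dist.
Qed.

(** Real-valued for the sake of arithmetic; for empty [X] it takes the meaningless value 0, hence
    the assumption [X !=set0] below. *)
Definition tdist X x : R := fine (torus_dist_set x X).

Lemma torus_dist_setE X x : X !=set0 -> torus_dist_set x X = (tdist X x)%:E.
Proof.
move=> [y Xy]; rewrite /tdist fineK// fin_numE; apply/andP; split.
  rewrite -ltNye (@lt_le_trans _ _ 0%E)// le_ereal_inf_tmp// => _ [z _ <-].
  by rewrite lee_fin torus_dist_ge0.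
rewrite -ltey (@le_lt_trans _ _ (torus_dist x y)%:E) ?ltry//.
by apply: ereal_inf_lbound; exists y.
Qed.

Lemma tdist_le X x y : X y -> tdist X x <= torus_dist x y.
Proof.
move=> Xy; have X0 : X !=set0 by exists y.
by rewrite -lee_fin -torus_dist_setE//; apply: ereal_inf_lbound; exists y.
Qed.

(** [X] need not be closed, so a nearest point may not exist and a slack [e] is allowed. *)
Lemma tdist_adherent X x e : X !=set0 -> 0 < e ->
  exists2 y, X y & torus_dist x y < tdist X x + e.
Proof.
move=> X0 e0.
have : (torus_dist_set x X < (tdist X x + e)%:E)%E.
  by rewrite torus_dist_setE// lte_fin ltrDl.
by move=> /ereal_inf_lt[_ [y Xy <-]]; rewrite lte_fin; exists y.
Qed.

Lemma tdist_ge0 X x : X !=set0 -> 0 <= tdist X x.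
Proof.
move=> X0; rewrite -lee_fin -torus_dist_setE//.
by rewrite le_ereal_inf_tmp// => _ [z _ <-]; rewrite lee_fin torus_dist_ge0.
Qed.

Lemma tdist_triangle X x y : X !=set0 ->
  tdist X x <= torus_dist x y + tdist X y.
Proof.
move=> X0; apply/ler_addgt0Pr => e e0.
have [z Xz yz] := tdist_adherent y X0 e0.
rewrite (le_trans (tdist_le x Xz))// (le_trans (torus_dist_triangle x y z))//.
by rewrite -addrA lerD2l ltW.
Qed.

Lemma torus_compact : compact [set: torus R N].
Proof.
have := @rV_compact (circle R) N (fun=> setT) (fun=> circle_compact).
by congr compact; apply/seteqP; split.
Qed.

Lemma torus_ball_lt x y r : 0 < r -> torus_dist x y < r -> ball x r y.
Proof.
move=> r0 xy; split=> // i j; rewrite !ord1 ballEmdist /=.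
exact: le_lt_trans (mdist_le_torus_dist _ _ _) xy.
Qed.

(** The uniform radius comes from the compactness of the closure; if a limit point of [X] were
    outside [U], the admissible radii could shrink to 0 near it. *)
Lemma closure_nbh X U : open U -> closure X `<=` U ->
  exists2 r, 0 < r & forall x y, X y -> torus_dist x y < r -> U x.
Proof.
move=> oU XU.
have cX : compact (closure X).
  exact: (subclosed_compact (@closed_closure _ X) torus_compact).
have /compact_near_coveringP/(_ R (0^'+) (fun r y => ball y r `<=` U)) := cX.
have hU p : closure X p -> \forall p' \near p & r \near 0^'+, ball p' r `<=` U.
  move=> /XU Up; have /nbhs_ballP[e /= e0 eU] : nbhs p U by exact: open_nbhs_nbhs.
  exists (ball p (e / 2), [set r | r < e / 2]).
    split; first by apply: nbhsx_ballx; rewrite divr_gt0.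
    by apply: nbhs_right_lt; rewrite divr_gt0.
  move=> [p' r] [/= pp' re] q p'q; apply: eU; rewrite [e]splitr.
  exact: ball_triangle pp' (le_ball (ltW re) p'q).
move=> /(_ _ hU) hr.
near (0 : R)^'+ => r.
have r0 : 0 < r by near: r; exact: nbhs_right_gt.
have Xr : closure X `<=` (fun y => ball y r `<=` U) by near: r.
exists r => // x y Xy xyr; apply: (Xr y); first exact: subset_closure.
by apply: torus_ball_lt; rewrite // torus_dist_sym.
Unshelve. all: by end_near.
Qed.

End TorusGeometry.

(** * One step of the dynamics *)

Lemma sum_norm_le (R : realType) (N : nat) (a : 'I_N -> R) (c : R) :
  (forall j, `|a j| <= c) -> `|\sum_(j < N) a j| <= N%:R * c.
Proof.
move=> ac; rewrite (le_trans (ler_norm_sum _ _ _))//.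
rewrite (le_trans (ler_sum _ (fun j _ => ac j)))//.
by rewrite sumr_const card_ord mulr_natl.
Qed.

Lemma uniform_bounds (R : realType) (N : nat)
  (f : 'I_N -> circle R -> circle R)
  (h : 'I_N -> 'I_N -> circle R -> circle R -> R) :
  (forall i, circle_C2 (f i)) -> (forall i j, circle2_C2 (h i j)) ->
  exists K f1 h1, [/\ 1 <= K, forall i, map_bounds K (f i) (f1 i) &
    forall i j, interaction_bounds K (h i j) (h1 i j)].
Proof.
move=> hf hh.
have /choice[Kf] := fun i => circle_C2_bounds (hf i).
move=> /choice[f1 Hf].
have /choice[Kh] := fun ij => circle2_C2_bounds (hh ij.1 ij.2).
move=> /choice[h1 Hh].
have Kf0 i : 0 <= Kf i by have [] := Hf i.
have Kh0 ij : 0 <= Kh ij by have [] := Hh ij.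
(* The sum dominates every constant, and the summand 1 gives [1 <= K] even for an empty index
   set. *)
exists (1 + \sum_i Kf i + \sum_ij Kh ij), f1, (fun i j => h1 (i, j)); split.
- by rewrite -addrA lerDl addr_ge0// sumr_ge0.
- move=> i; apply: map_boundsW (proj2 (Hf i)).
  rewrite (bigD1 i)//=.
  have : 0 <= \sum_(j | j != i) Kf j by exact: sumr_ge0.
  have : 0 <= \sum_ij Kh ij by exact: sumr_ge0.
  lra.
- move=> i j; apply: interaction_boundsW (proj2 (Hh (i, j))).
  rewrite [\sum_ij Kh ij](bigD1 (i, j))//=.
  have : 0 <= \sum_(ij | ij != (i, j)) Kh ij by exact: sumr_ge0.
  have : 0 <= \sum_i Kf i by exact: sumr_ge0.
  lra.
Qed.

Section OneStep.
Context {R : realType} {N : nat}.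
Variables (f : 'I_N -> circle R -> circle R)
  (h : 'I_N -> 'I_N -> circle R -> circle R -> R)
  (K : R) (f1 : 'I_N -> circle R -> R)
  (h1 : 'I_N -> 'I_N -> circle R -> circle R -> R).
Hypotheses (K1 : 1 <= K) (fK : forall i, map_bounds K (f i) (f1 i))
  (hK : forall i j, interaction_bounds K (h i j) (h1 i j)).
Implicit Types (x y : circle R) (z : torus R N)
  (nu : 'I_N -> probability (circle R) R)
  (rho : R) (i j : 'I_N).

Let n : R := N%:R.
Let n0 : 0 <= n. Proof. exact: ler0n. Qed.
Let K0 : 0 <= K. Proof. exact: le_trans ler01 K1. Qed.

(** The outer [K] accounts for [f i], the 1 for the displacement of the point itself, and
    [2 * n * K] for N interactions, each with both arguments displaced. *)
Definition step_const : R := K * (1 + 2 * n * K).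
Local Notation L := step_const.

Lemma step_const_ge1 : 1 <= L.
Proof.
have nK : 0 <= n * K by rewrite mulr_ge0.
by rewrite /L mulr_ege1//; lra.
Qed.

(** Replaces the topological support: a statement about full mass passes to push-forwards by taking
    preimages. *)
Definition supported nu z rho : Prop := forall j, nu j (cball (z 0 j) rho) = 1%E.

Let h_lip i j x x' y y' :
  `|h i j x y - h i j x' y'| <= K * (mdist x x' + mdist y y').
Proof. by have [_ + _ _] := hK i j; apply. Qed.

Let h_lip2 i j x y y' : `|h i j x y - h i j x y'| <= K * mdist y y'.
Proof. by have := h_lip i j x x y y'; rewrite mdistxx add0r. Qed.

Let f_lip i x y : mdist (f i x) (f i y) <= K * mdist x y.
Proof. by have [_ + _ _] := fK i; apply. Qed.

Lemma field_close nu z rho i j x w : supported nu z rho ->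
  `|\int[nu j]_(y in setT) h i j x y - h i j w (z 0 j)| <= K * (mdist x w + rho).
Proof.
move=> nuz; apply: (Rintegral_cst_le (measurable_cball _ _) (nuz j) (h_lip2 i j x)).
move=> y zy; rewrite (le_trans (h_lip _ _ _ _ _ _))// ler_wpM2l// lerD2l.
by rewrite metric_sym.
Qed.

Lemma step_close nu z rho i x : supported nu z rho -> mdist (z 0 i) x <= rho ->
  mdist (G_map f h z 0 i) (sc_map f h nu i x) <= L * rho.
Proof.
move=> nuz zx; have rho0 : 0 <= rho by exact: le_trans (mdist_ge0 _ _) zx.
rewrite /G_map mxE /point_map /sc_map (le_trans (f_lip _ _ _))//.
rewrite /L -mulrA ler_wpM2l//.
set s := \sum_(j < N) h i j (z 0 i) (z 0 j).
rewrite (le_trans (metric_triangle _ (x + tocircle s) _))//.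
have -> : (1 + 2 * n * K) * rho = rho + n * (K * (rho + rho)) by ring.
apply: lerD.
  by rewrite mdist_addr.
rewrite (le_trans (mdist_tocircleD _ _ _))// -sumrB; apply: sum_norm_le => j.
rewrite distrC (le_trans (field_close _ _ _ _ nuz))// ler_wpM2l// lerD2r.
by rewrite metric_sym.
Qed.

Lemma sc_map_continuous nu i : continuous (sc_map f h nu i).
Proof.
apply: (@lipschitz_continuous_metric _ _ _ (K * (1 + n * K))) => x x'.
rewrite /sc_map (le_trans (f_lip _ _ _))// -mulrA ler_wpM2l//.
set s := \sum_(j < N) _; set s' := \sum_(j < N) _.
rewrite (le_trans (metric_triangle _ (x + tocircle s') _))//.
rewrite mulrDl mul1r addrC lerD//.
  by rewrite mdist_addr.
rewrite (le_trans (mdist_tocircleD _ _ _))// -sumrB -mulrA; apply: sum_norm_le => j.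
rewrite -[X in `|X|]subr0.
apply: (Rintegral_sub_le measurableT (probability_setT _)
  (h_lip2 i j x) (h_lip2 i j x')).
by move=> y _; rewrite subr0; have := h_lip i j x x' y y; rewrite mdistxx addr0.
Qed.

Lemma G_map_lipschitz z z' :
  torus_dist (G_map f h z) (G_map f h z') <= L * torus_dist z z'.
Proof.
have d0 := torus_dist_ge0 z z'.
apply: torus_dist_le => [|i].
  by rewrite mulr_ge0// (le_trans ler01)// step_const_ge1.
have zz j := mdist_le_torus_dist z z' j.
rewrite /G_map !mxE /point_map (le_trans (f_lip _ _ _))//.
rewrite /L -mulrA ler_wpM2l//.
set d := torus_dist z z' in zz d0 *.
have -> : (1 + 2 * n * K) * d = n * (K * (d + d)) + d by ring.
set s := \sum_(j < N) _; set s' := \sum_(j < N) _.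
rewrite (le_trans (metric_triangle _ (z 0 i + tocircle s') _))// lerD//.
  rewrite (le_trans (mdist_tocircleD _ _ _))// -sumrB; apply: sum_norm_le => j.
  by rewrite (le_trans (h_lip _ _ _ _ _ _))// ler_wpM2l// lerD.
by rewrite mdist_addr.
Qed.

(** [w] is the argument of [f i]; [c] is its derivative when the point moves while the masses at
    [z 0 j] stay fixed, even for [j = i]. *)
Let w i z : circle R := z 0 i + tocircle (\sum_(j < N) h i j (z 0 i) (z 0 j)).
Let c i z : R := 1 + \sum_(j < N) h1 i j (z 0 i) (z 0 j).

(** Chain rule, with the argument of [f i] written as [w i z] displaced by [u t], so that
    [u 0 = 0]. *)
Lemma g_funE i z : g_fun f h i z = f1 i (w i z) * c i z.
Proof.
pose u t := t + \sum_(j < N)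
  (h i j (z 0 i + tocircle t) (z 0 j) - h i j (z 0 i) (z 0 j)).
have u0 : u 0 = 0.
  by rewrite /u add0r big1// => j _; rewrite tocircle0 addr0 subrr.
have uc : is_derive (0 : R) 1 u (c i z).
  have -> : u = id + \sum_(j < N) (fun t : R =>
      h i j (z 0 i + tocircle t) (z 0 j) - h i j (z 0 i) (z 0 j)).
    by apply/funext => t; rewrite /u fctE fct_sumE.
  apply: is_deriveD; apply: is_derive_sum => j.
  have [_ _ + _] := hK i j => /(_ (z 0 i) (z 0 j)) hd.
  by rewrite -[h1 _ _ _ _]subr0; apply: is_deriveB.
have [_ _ _ fd] := fK i; rewrite -(fd (w i z) u (c i z) u0 uc) /g_fun /circle_deriv.
congr (derive1 _ 0); apply/funext => t; congr (srep (_ - _)).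
rewrite /point_map /w /u; congr (f i _).
rewrite -addrA -addrA; congr (_ + _); rewrite -!tocircleD; congr tocircle.
by rewrite sumrB addrCA subrKC.
Qed.

Lemma coef_le i z : `|c i z| <= 1 + n * K.
Proof.
rewrite (le_trans (ler_normD _ _))// normr1 lerD2l; apply: sum_norm_le => j.
by have [+ _ _ _] := hK i j; apply.
Qed.

Lemma g_fun_le i z : `|g_fun f h i z| <= L.
Proof.
rewrite g_funE normrM ler_pM//; first by have [+ _ _ _] := fK i; apply.
have nK : 0 <= n * K by rewrite mulr_ge0.
by rewrite (le_trans (coef_le _ _))//; lra.
Qed.

(** The displacement [u] has Lipschitz constant [|c| + O(rho)] and [f i] has [|f1| + O(rho)]; the
    leading term of the product is [|g_fun|]. The factor 4 keeps [L * rho] below 1/2, and also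
    [|t - s| <= 2 * rho], so that the circle distance equals [|t - s|]. *)
Lemma step_contraction nu z rho i x y : supported nu z rho ->
    4 * L * rho < 1 -> mdist (z 0 i) x <= rho -> mdist (z 0 i) y <= rho ->
  mdist (sc_map f h nu i x) (sc_map f h nu i y)
    <= (`|g_fun f h i z| + 3 * L ^+ 3 * rho) * mdist x y.
Proof.
move=> nuz Lrho zx zy.
have rho0 : 0 <= rho by exact: le_trans (mdist_ge0 _ _) zx.
have L1 := step_const_ge1.
have rL : rho <= L * rho by rewrite ler_peMl.
(* Coordinates centred at [w i z], the argument of [f i] at the reference
   point: the displacement [t] of [z 0 i] becomes the displacement [u t]. *)
pose u t := t + \sum_(j < N)
  (\int[nu j]_(y in setT) h i j (z 0 i + tocircle t) y -
   h i j (z 0 i) (z 0 j)).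
have uE v : sc_map f h nu i v = f i (w i z + tocircle (u (srep (v - z 0 i)))).
  set t := srep _; have vE : v = z 0 i + tocircle t by rewrite addr_srepB.
  rewrite /sc_map /w /u -vE; congr (f i _); rewrite {1}vE -addrA -addrA.
  congr (_ + _); rewrite -!tocircleD; congr tocircle.
  by rewrite sumrB addrCA subrKC.
have u_le t : `|t| <= rho -> `|u t| <= L * rho.
  move=> tr; rewrite (le_trans (ler_normD _ _))//.
  apply: (@le_trans _ _ (rho + n * (K * (rho + rho)))).
    rewrite lerD//; apply: sum_norm_le => j.
    rewrite (le_trans (field_close _ _ _ _ nuz))// ler_wpM2l// lerD2r.
    have := mdist_tocircleD (z 0 i) t 0; rewrite tocircle0 addr0 subr0 => /le_trans.
    exact.
  have -> : rho + n * (K * (rho + rho)) = (1 + 2 * n * K) * rho by ring.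
  by rewrite /L ler_wpM2r// ler_peMl//; have := mulr_ge0 n0 K0; lra.
set t := srep (x - z 0 i); set s := srep (y - z 0 i).
have tr : `|t| <= rho by rewrite norm_srepB.
have sr : `|s| <= rho by rewrite norm_srepB.
have uts : `|u t - u s| <= (`|c i z| + n * K * rho) * `|t - s|.
  have : `|u t - u s - c i z * (t - s)| <= n * (K * rho * `|t - s|).
    have -> : u t - u s - c i z * (t - s) =
      \sum_(j < N) (\int[nu j]_(y in setT) h i j (z 0 i + tocircle t) y -
         \int[nu j]_(y in setT) h i j (z 0 i + tocircle s) y -
         h1 i j (z 0 i) (z 0 j) * (t - s)).
      rewrite !sumrB -mulr_suml /u /c !sumrB; ring.
    apply: sum_norm_le => j.
    apply: (Rintegral_sub_le (measurable_cball _ _) (nuz j)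
      (h_lip2 i j _) (h_lip2 i j _)).
    move=> v zv; have [_ _ _ + ] := hK i j; apply => //; lra.
  have := ler_normD (u t - u s - c i z * (t - s)) (c i z * (t - s)).
  rewrite subrK normrM; lra.
have xy : mdist x y = `|t - s|.
  rewrite -(addr_srepB (z 0 i) x) -(addr_srepB (z 0 i) y) mdist_tocircleD_small//.
  have := ler_normB t s; rewrite /t /s in tr sr *; lra.
rewrite !uE xy.
have [_ _ fd _] := fK i.
have Lr2 : L * rho <= 2^-1 by lra.
apply: (le_trans (fd (w i z) _ _ _ Lr2 (u_le t tr) (u_le s sr))).
apply: (le_trans (ler_wpM2l _ uts)).
  by rewrite addr_ge0// mulr_ge0//; lra.
rewrite [leLHS]mulrA ler_wpM2r// g_funE normrM.
have f1K : `|f1 i (w i z)| <= K by have [+ _ _ _] := fK i; apply.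
have cK := coef_le i z.
have nK : 0 <= n * K by rewrite mulr_ge0.
have KL : K <= L by rewrite /L ler_peMr//; lra.
have cL : 1 + 2 * (n * K) <= L by rewrite /L -mulrA ler_peMl//; lra.
have L0 : 0 <= L by lra.
have KLr0 : 0 <= K * (L * rho) by rewrite mulr_ge0//; lra.
have nKr0 : 0 <= n * K * rho by rewrite mulr_ge0.
have nKL : n * K <= L by lra.
have Lr0 : 0 <= L * rho by lra.
(* [r1], [r2], [r3] bound the three remaining terms of the product; [r4] brings them all to
   [L ^+ 3 * rho], hence the coefficient 3. *)
have r1 : `|f1 i (w i z)| * (n * K * rho) <= L ^+ 2 * rho.
  rewrite expr2 -[leRHS]mulrA; apply: ler_pM => //; first exact: le_trans KL.
  exact: ler_wpM2r.
have r2 : K * (L * rho) * `|c i z| <= L ^+ 3 * rho.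
  rewrite (_ : L ^+ 3 * rho = L * (L * rho) * L); last by ring.
  by apply: ler_pM => //; [exact: ler_wpM2r|lra].
have r3 : K * (L * rho) * (n * K * rho) <= L ^+ 2 * rho.
  rewrite (_ : L ^+ 2 * rho = L * 1 * (L * rho)); last by ring.
  by apply: ler_pM => //; [apply: ler_pM => //; lra|exact: ler_wpM2r].
have r4 : L ^+ 2 * rho <= L ^+ 3 * rho.
  by rewrite ler_wpM2r// [leRHS]exprS ler_peMl// exprn_ge0.
lra.
Qed.

End OneStep.

(** * Iteration *)

(** With all factors at most [L + 1], each of the [n] additions of [e] changes the product by at
    most [e * (L + 1) ^+ n]. *)
Lemma prod_perturb (R : realType) (L e : R) (a : nat -> R) n :
    1 <= L -> 0 <= e -> e <= 1 -> (forall k, 0 <= a k <= L) ->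
  \prod_(0 <= k < n) (a k + e)
    <= \prod_(0 <= k < n) a k + e * (n%:R * (L + 1) ^+ n).
Proof.
move=> L1 e0 e1 aL; elim: n => [|n IH].
  by rewrite !big_geq// mul0r mulr0 addr0.
rewrite !big_nat_recr//=; set P := \prod_(_ <= _ < _) a _ in IH *.
have /andP[an0 anL] := aL n.
apply: (le_trans (ler_wpM2r _ IH)); first lra.
have PL : 0 <= P <= (L + 1) ^+ n.
  rewrite prodr_ge0 => [|i _]; last by have /andP[] := aL i.
  rewrite -[n in leRHS]subn0 -prodr_const_nat ler_prod// => i _.
  by have /andP[-> ?] := aL i; lra.
have /andP[P0 {}PL] := PL.
set E := (L + 1) ^+ n in PL *.
rewrite -natr1 exprS -/E.
have nE : 0 <= n%:R * E by rewrite mulr_ge0// (le_trans P0).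
have : e * P <= e * E by rewrite ler_wpM2l.
have : e * (n%:R * E) * (a n + e) <= e * (n%:R * E) * (L + 1).
  by rewrite ler_wpM2l ?mulr_ge0//; lra.
have : e * E <= e * (E * (L + 1)).
  by rewrite ler_wpM2l// ler_peMr ?(le_trans P0)//; lra.
nra.
Qed.

(** Turns a rate per block into a rate per step without extracting roots: the n-th power of
    [1 - (1 - a) / n] is at least [a]. *)
Lemma bernoulli_ineq (R : realType) (u : R) n :
  0 <= u <= 1 -> 1 - n%:R * u <= (1 - u) ^+ n.
Proof.
move=> /andP[u0 u1]; elim: n => [|n IH]; first by rewrite mul0r subr0 expr0.
rewrite exprS -natr1; have := ler_wpM2l (_ : 0 <= 1 - u) IH.
rewrite subr_ge0 => /(_ u1); have : 0 <= n%:R * (u * u) by rewrite !mulr_ge0.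
nra.
Qed.

Section Iteration.
Context {R : realType} {N : nat}.
Variables (f : 'I_N -> circle R -> circle R)
  (h : 'I_N -> 'I_N -> circle R -> circle R -> R) (L : R).
Implicit Types (x z : torus R N) (nu : 'I_N -> probability (circle R) R)
  (rho l : R) (i : 'I_N) (k : nat).

Local Notation G := (G_map f h).
Local Notation F := (sc_transfer f h).
Local Notation g := (g_fun f h).

(** The iteration sees the regularity of [f] and [h] only through these one-step estimates, all with
    the same [L]. *)
Hypotheses (L1 : 1 <= L)
  (step_closeL : forall nu z rho i y, supported nu z rho ->
     mdist (z 0 i) y <= rho -> mdist (G z 0 i) (sc_map f h nu i y) <= L * rho)
  (sc_cont : forall nu i, continuous (sc_map f h nu i))
  (G_lip : forall z z', torus_dist (G z) (G z') <= L * torus_dist z z')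
  (g_le : forall i z, `|g i z| <= L)
  (contract : forall nu z rho i y y', supported nu z rho ->
     4 * L * rho < 1 -> mdist (z 0 i) y <= rho -> mdist (z 0 i) y' <= rho ->
     mdist (sc_map f h nu i y) (sc_map f h nu i y')
       <= (`|g i z| + 3 * L ^+ 3 * rho) * mdist y y').

Let L0 : 0 <= L. Proof. exact: le_trans L1. Qed.

Definition sc_point nu x : torus R N := \row_i sc_map f h nu i (x 0 i).

(** The orbit of [x] under the time-dependent maps generated by the measures, not under [G]:
    [contract] compares two points moved by the same map. *)
Fixpoint shadow nu x k : torus R N :=
  if k is k'.+1 then sc_point (iter k' F nu) (shadow nu x k') else x.

Lemma supported_sub nu x z l rho : supported nu x l ->
  torus_dist z x + l <= rho -> supported nu z rho.
Proof.
move=> nux zx i; apply: probability_full_sub (nux i); try exact: measurable_cball.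
move=> y; rewrite /cball/= => xy.
have := metric_triangle (z 0 i) (x 0 i) y; have := mdist_le_torus_dist z x i.
lra.
Qed.

(** Used twice in a block: with [z] in [X] to stay near an orbit in [X], and with [z = x] to compare
    the centre with the [G]-orbit of [x]. *)
Lemma shadow_near nu z x rho k : supported nu z rho -> torus_dist z x <= rho ->
  supported (iter k F nu) (iter k G z) (L ^+ k * rho) /\
  torus_dist (iter k G z) (shadow nu x k) <= L ^+ k * rho.
Proof.
move=> nuz zx; have rho0 : 0 <= rho by exact: le_trans (torus_dist_ge0 _ _) zx.
elim: k => [|k [IHs IHd]]; first by rewrite expr0 mul1r.
rewrite exprS -mulrA /=; split=> [i|].
  apply: transfer_cball (IHs i) => //; first exact: measurable_cball.
  by move=> y; exact: step_closeL.
apply: torus_dist_le => [|i]; first by rewrite !mulr_ge0// exprn_ge0.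
rewrite [sc_point _ _ _ _]mxE; apply: step_closeL => //.
exact: le_trans (mdist_le_torus_dist _ _ _) IHd.
Qed.

(** The coarse radius [rho] about [z] makes [contract] applicable; the fine radius [l] about [x] is
    the one that shrinks. The intersection of both balls still carries full mass. *)
Lemma shadow_contract nu z x rho l n : 0 <= l ->
    supported nu z rho -> supported nu x l -> torus_dist z x <= rho ->
    4 * L ^+ n.+1 * rho < 1 ->
  forall k i, (k <= n)%N ->
    iter k F nu i (cball (shadow nu x k 0 i)
      (\prod_(0 <= j < k) (`|g i (iter j G z)| + 3 * L ^+ 3 * (L ^+ n * rho)) * l))
    = 1%E.
Proof.
move=> l0 nuz nux zx Lrho k i; elim: k => [|k IH] kn.
  by rewrite big_geq// mul1r; exact: nux.
have rho0 : 0 <= rho by exact: le_trans (torus_dist_ge0 _ _) zx.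
have [nukz zkx] := shadow_near k nuz zx.
rewrite big_nat_recr//=; set P := \prod_(_ <= _ < _) _ in IH *.
have nuk := IH (ltnW kn).
have mc := measurable_cball.
have := probability_full_setI (mc _ _ _) (mc _ _ _) (nukz i) nuk.
apply: transfer_cball => //; first by apply: measurableI; exact: mc.
move=> y [/= zy xy]; rewrite mxE.
(* The coarse radius is frozen at [L ^+ n * rho], so that all factors get the same error, as in
   [prod_perturb]. *)
have Lk : L ^+ k * rho <= L ^+ n * rho.
  by rewrite ler_wpM2r// ler_weXn2l// ltnW.
have zkxi : mdist (iter k G z 0 i) (shadow nu x k 0 i) <= L ^+ k * rho.
  exact: le_trans (mdist_le_torus_dist _ _ _) zkx.
apply: (le_trans (contract nukz _ zkxi zy)).
  rewrite (le_lt_trans _ Lrho)// -!mulrA ler_wpM2l// exprS -mulrA ler_wpM2l//.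
rewrite [leRHS]mulrAC [leRHS]mulrC; apply: (ler_pM _ (mdist_ge0 _ _) _ xy).
  by rewrite addr_ge0// !mulr_ge0// exprn_ge0.
by rewrite lerD2l ler_wpM2l// mulr_ge0// exprn_ge0.
Qed.

Lemma G_iter_lipschitz z z' k :
  torus_dist (iter k G z) (iter k G z') <= L ^+ k * torus_dist z z'.
Proof.
elim: k => [|k IH]; first by rewrite expr0 mul1r.
by rewrite exprS -mulrA /= (le_trans (G_lip _ _))// ler_wpM2l.
Qed.

Variables (X U : set (torus R N)) (lambda : R) (n0 : nat) (rU : R).
Hypotheses (X0 : X !=set0) (hl : 0 < lambda < 1) (XG : forall x, X x -> X (G x))
  (rU0 : 0 < rU) (XU : forall x y, X y -> torus_dist x y < rU -> U x)
  (attr : forall x, U x ->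
     (torus_dist_set (iter n0 G x) X <= lambda%:E * torus_dist_set x X)%E)
  (gX : forall x, X x -> forall i,
     `|\prod_(0 <= j < n0) g i (iter j G x)| <= lambda).

(* [D] is chosen so that, when every ball lies within [L ^ n0 * rho0] of the
   orbit of a point of [X], the product in [gX] is perturbed by at most
   [(1 - lambda) / 4]. *)
Let D : R := 4 * L ^+ n0.+1
  + 3 * L ^+ 3 * L ^+ n0 * (1 + n0%:R * (L + 1) ^+ n0).
Let rho0 : R := (1 - lambda) / (4 * D).

Let D_gt0 : 0 < D.
Proof.
have L0' : 0 < L by exact: lt_le_trans L1.
rewrite /D ltr_wpDr ?mulr_gt0 ?exprn_gt0// ?mulr_ge0 ?exprn_ge0//.
by rewrite addr_ge0// mulr_ge0// exprn_ge0// addr_ge0.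
Qed.

Let rho0_gt0 : 0 < rho0.
Proof. by rewrite divr_gt0 ?mulr_gt0 ?D_gt0//; move: hl; lra. Qed.

Let rate : R := lambda + (1 - lambda) / 4.

(** For the radius, [gX] is used along the orbit of a nearby [z] in [X]; for the centre, [attr] is
    used along the [G]-orbit of [x]. *)
Lemma block nu x l : 0 <= l -> supported nu x l -> tdist X x + l < rho0 ->
    tdist X x < rU ->
  exists x', supported (iter n0 F nu) x' (rate * l) /\
    tdist X x' <= lambda * tdist X x + L ^+ n0 * l.
Proof.
move=> l0 nux xl xU; exists (shadow nu x n0).
(* The slack is what remains of [rho0], so that the balls around [x] fit into those around [z]. *)
have [z Xz xz] : exists2 z, X z &
    torus_dist x z < tdist X x + (rho0 - l - tdist X x).
  by apply: tdist_adherent => //; lra.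
have {}xz : torus_dist z x + l <= rho0 by rewrite torus_dist_sym; lra.
have nuz := supported_sub nux xz.
have zx : torus_dist z x <= rho0 by lra.
have Dr : D * rho0 = (1 - lambda) / 4.
  by rewrite /rho0; field; exact: lt0r_neq0 D_gt0.
pose e := 3 * L ^+ 3 * (L ^+ n0 * rho0).
have r0 : 0 <= rho0 by exact: ltW rho0_gt0.
have Lk k : 0 <= L ^+ k by exact: exprn_ge0.
have p1 : 0 <= e := mulr_ge0 (mulr_ge0 (ler0n _ 3) (Lk 3)) (mulr_ge0 (Lk n0) r0).
have p2 : 0 <= 4 * L ^+ n0.+1 * rho0.
  exact: (mulr_ge0 (mulr_ge0 (ler0n _ 4) (Lk n0.+1)) r0).
have p3 : 0 <= e * (n0%:R * (L + 1) ^+ n0).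
  by rewrite mulr_ge0// mulr_ge0// exprn_ge0// addr_ge0.
have De : D * rho0 = 4 * L ^+ n0.+1 * rho0 + e + e * (n0%:R * (L + 1) ^+ n0).
  by rewrite /D /e; ring.
have hl' := hl; split=> [i|].
  have Lr : 4 * L ^+ n0.+1 * rho0 < 1 by lra.
  have := shadow_contract l0 nuz nux zx Lr i (leqnn n0).
  apply: probability_full_sub; try exact: measurable_cball.
  move=> y; rewrite /cball/= => /le_trans; apply.
  rewrite ler_wpM2r//.
  have aL k : 0 <= `|g i (iter k G z)| <= L by rewrite normr_ge0 g_le.
  have e1 : e <= 1 by lra.
  rewrite (le_trans (prod_perturb n0 L1 p1 e1 aL))//.
  have := gX Xz i; rewrite normr_prod /rate; lra.
have xx : torus_dist x x <= l.
  by apply: torus_dist_le => // i; rewrite mdistxx.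
have [_ d1] := shadow_near n0 nux xx.
(* Another point of [X], within [rU] of [x], shows that [x] lies in [U]. *)
have [y Xy xy] : exists2 y, X y & torus_dist x y < tdist X x + (rU - tdist X x).
  by apply: tdist_adherent => //; lra.
have Ux : U x by apply: (XU Xy); lra.
have := attr Ux; rewrite !torus_dist_setE// -EFinM lee_fin => d2.
rewrite (le_trans (tdist_triangle _ (iter n0 G x) X0))// torus_dist_sym; lra.
Qed.

(* [Q * (1 - lambda) / 4 = L ^ n0] absorbs the displacement of the centre
   in [block]. *)
Let Q : R := 4 * L ^+ n0 / (1 - lambda).
(** [rate] plus the quarter of [1 - lambda] that [Q] spends on the displacement of the centre. *)
Let Lam : R := lambda + (1 - lambda) / 2.
Let sigma : R := Num.min rho0 rU.

Let Q_ge1 : 1 <= Q.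
Proof.
have hl' := hl; rewrite /Q ler_pdivlMr; last lra.
have : 1 <= L ^+ n0 by rewrite exprn_ege1.
lra.
Qed.

Lemma block_iter nu x l q : 0 <= l -> supported nu x l ->
    tdist X x + Q * l < sigma ->
  exists x' l', [/\ 0 <= l', supported (iter (q * n0) F nu) x' l' &
    tdist X x' + Q * l' <= Lam ^+ q * sigma].
Proof.
move=> l0 nux V0; have hl' := hl.
have s0 : 0 < sigma by rewrite lt_min rho0_gt0 rU0.
have [sr sU] : sigma <= rho0 /\ sigma <= rU by rewrite !ge_min !lexx orbT.
(* The strict bound is carried along: [block] needs it, and at [q = 0] the other bound is only a
   weak one by [sigma]. *)
suff : exists x' l', [/\ 0 <= l', supported (iter (q * n0) F nu) x' l',
    tdist X x' + Q * l' < sigma & tdist X x' + Q * l' <= Lam ^+ q * sigma].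
  by move=> [x' [l' [? ? ? ?]]]; exists x', l'.
elim: q => [|q [y [m [m0 nuy Vs Vq]]]].
  by exists x, l; split=> //; rewrite expr0 mul1r ltW.
have Qm : m <= Q * m by rewrite ler_peMl.
have t0 := tdist_ge0 y X0.
have [||y' [nuy' ty']] := block m0 nuy; [lra|lra|].
have V' : tdist X y' + Q * (rate * m) <= Lam * (tdist X y + Q * m).
  have : Q * ((1 - lambda) / 4) = L ^+ n0.
    by rewrite /Q; field; lra.
  have : lambda * tdist X y <= Lam * tdist X y by rewrite ler_wpM2r// /Lam; lra.
  rewrite /Lam /rate; nra.
have Lam01 : 0 <= Lam <= 1 by rewrite /Lam; apply/andP; split; lra.
have /andP[Lam0 Lam1] := Lam01.
have W0 : 0 <= tdist X y + Q * m by lra.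
exists y', (rate * m); split.
- by rewrite mulr_ge0// /rate; lra.
- by rewrite mulSn iterD.
- by rewrite (le_lt_trans V')// (le_lt_trans _ Vs)// ler_piMl.
- by rewrite (le_trans V')// exprS -mulrA ler_wpM2l.
Qed.

(** The balls are recentred at a point of [X] almost nearest to [x]. *)
Lemma wasserstein_set_le nu x l e : 0 <= l -> supported nu x l -> 0 < e ->
  (wasserstein_set nu (dirac_tuples X) <= (tdist X x + l + e)%:E)%E.
Proof.
move=> l0 nux e0; have [y Xy xy] := tdist_adherent x X0 e0.
have nuy : supported nu y (tdist X x + l + e).
  by apply: supported_sub nux _; rewrite torus_dist_sym; lra.
pose dy := fun i => dirac (y 0 i) : probability (circle R) R.
apply: (@le_trans _ _ (wassersteinN nu dy)).
  by apply: ereal_inf_lbound; exists dy => //; exists y.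
apply: bigmax_le => [|i _]; last exact: wasserstein_dirac_le.
by rewrite lee_fin; have := tdist_ge0 x X0; lra.
Qed.

(** Serves the incomplete last block: invariance of [X] turns the Lipschitz bound for [G] into one
    for the distance to [X]. *)
Lemma tdist_iter_G x k : tdist X (iter k G x) <= L ^+ k * tdist X x.
Proof.
have XGk z : X z -> X (iter k G z) by move=> Xz; elim: k => //= k; exact: XG.
apply/ler_addgt0Pr => e e0.
have Lk0 : 0 < L ^+ k by rewrite exprn_gt0// (lt_le_trans ltr01).
have [z Xz xz] := tdist_adherent x X0 (divr_gt0 e0 Lk0).
rewrite (le_trans (tdist_le _ (XGk _ Xz)))// (le_trans (G_iter_lipschitz _ _ _))//.
rewrite (le_trans (ler_wpM2l (ltW Lk0) (ltW xz)))// mulrDr mulrCA divff ?mulr1//.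
by rewrite gt_eqF.
Qed.

Lemma exponential_convergence : (0 < n0)%N ->
  exists r eps Lambda : R, [/\ 0 < r, 0 < eps, 0 < Lambda < 1 &
    forall nu x, supported nu x eps -> tdist X x < r ->
      exists2 C : R, 0 < C & forall n,
        (wasserstein_set (iter n F nu) (dirac_tuples X) <= (C * Lambda ^+ n)%:E)%E].
Proof.
move=> n00; have hl' := hl.
have s0 : 0 < sigma by rewrite lt_min rho0_gt0 rU0.
have Q0 : 0 < Q by apply: lt_le_trans Q_ge1.
have nR : 1 <= n0%:R :> R by rewrite ler1n.
have nR0 : 0 < n0%:R :> R by lra.
have Lam0 : 0 < Lam by rewrite /Lam; lra.
have Lam1 : Lam < 1 by rewrite /Lam; lra.
pose u := (1 - Lam) / n0%:R.
have u0 : 0 < u by rewrite divr_gt0//; lra.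
have u1 : u <= 1 - Lam by rewrite ler_pdivrMr// ler_peMr//; lra.
have Lu : Lam <= (1 - u) ^+ n0.
  have u01 : 0 <= u <= 1 by apply/andP; split; lra.
  apply: le_trans (bernoulli_ineq n0 u01).
  by rewrite /u mulrCA divff ?mulr1 ?gt_eqF// subKr.
have Lw0 : 0 < 1 - u by lra.
(* Each of the two terms of [tdist X x + Q * l] gets half of [sigma]. *)
exists (sigma / 2), (sigma / (2 * Q)), (1 - u); split.
- by rewrite divr_gt0.
- by rewrite divr_gt0// mulr_gt0.
- by apply/andP; split; lra.
move=> nu x nux xr.
have e0 : 0 < sigma / (2 * Q) by rewrite divr_gt0// mulr_gt0.
have V0 : tdist X x + Q * (sigma / (2 * Q)) < sigma.
  rewrite (_ : Q * _ = sigma / 2); first lra.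
  by field; rewrite gt_eqF.
have Ln0 : 0 < L ^+ n0 by rewrite exprn_gt0// (lt_le_trans ltr01).
(* The 2 adds the slack of [wasserstein_set_le] to centre and radius, [L ^+ n0] covers the
   incomplete block, and the division by [Lam] the rounding in [n %/ n0]. *)
exists (2 * L ^+ n0 * sigma / Lam) => [|n]; first by rewrite divr_gt0// !mulr_gt0.
have [y [l [l0 nuy Vq]]] := block_iter (n %/ n0) (ltW e0) nux V0.
have yy : torus_dist y y <= l by apply: torus_dist_le => // i; rewrite mdistxx.
have [nur _] := shadow_near (n %% n0) nuy yy.
have {}nur : supported (iter n F nu) (iter (n %% n0) G y) (L ^+ (n %% n0) * l).
  by rewrite {1}(divn_eq n n0) addnC iterD.
have Lq0 : 0 < Lam ^+ (n %/ n0) * sigma by rewrite mulr_gt0// exprn_gt0.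
have Lr0 : 0 <= L ^+ (n %% n0) by rewrite exprn_ge0.
apply: (le_trans (wasserstein_set_le (mulr_ge0 Lr0 l0) nur Lq0)).
rewrite lee_fin.
have td := tdist_iter_G y (n %% n0).
have Lrn : L ^+ (n %% n0) <= L ^+ n0 by rewrite ler_weXn2l// ltnW// ltn_pmod.
have b1 : L ^+ (n %% n0) * (tdist X y + l) <= L ^+ n0 * (Lam ^+ (n %/ n0) * sigma).
  have := tdist_ge0 y X0; have : l <= Q * l by rewrite ler_peMl.
  by move=> ? ?; apply: ler_pM => //; lra.
have b2 : Lam ^+ (n %/ n0) * sigma <= L ^+ n0 * (Lam ^+ (n %/ n0) * sigma).
  by rewrite ler_peMl ?(ltW Lq0)// exprn_ege1.
have b3 : Lam ^+ (n %/ n0) <= (1 - u) ^+ n / Lam.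
  rewrite ler_pdivlMr//.
  have h1 : Lam ^+ (n %/ n0) <= (1 - u) ^+ (n %/ n0 * n0).
    by rewrite mulnC exprM lerXn2r ?nnegrE ?exprn_ge0// ltW.
  have h2 : (1 - u) ^+ n0 <= (1 - u) ^+ (n %% n0).
    by rewrite ler_wiXn2l ?(ltW Lw0)//; [lra|rewrite ltnW// ltn_pmod].
  rewrite {2}(divn_eq n n0) exprD ler_pM ?exprn_ge0 ?(ltW Lam0)//.
  exact: le_trans h2.
have : 2 * L ^+ n0 * sigma * Lam ^+ (n %/ n0)
    <= 2 * L ^+ n0 * sigma * ((1 - u) ^+ n / Lam).
  by rewrite ler_wpM2l// !mulr_ge0// ltW.
rewrite (_ : 2 * L ^+ n0 * sigma / Lam * (1 - u) ^+ n =
  2 * L ^+ n0 * sigma * ((1 - u) ^+ n / Lam)); last by ring.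
lra.
Qed.

End Iteration.

Theorem theorem3p1 (R : realType) (N : nat)
  (f : 'I_N -> circle R -> circle R)
  (h : 'I_N -> 'I_N -> circle R -> circle R -> R)
  (hf : forall i, circle_C2 (f i))
  (hh : forall i j, circle2_C2 (h i j))
  (lambda : R) (hlambda : 0 < lambda < 1) (n0 : nat)
  (X : set (torus R N))
  (hXinv : G_map f h @` X `<=` X)
  (hXattr : exists U : set (torus R N),
    [/\ open U, closure X `<=` U, G_map f h @` U `<=` U &
        forall x, U x ->
          (torus_dist_set (iter n0 (G_map f h) x) X
             <= lambda%:E * torus_dist_set x X)%E])
  (hg : forall x, X x -> forall i,
    `|\prod_(0 <= j < n0) g_fun f h i (iter j (G_map f h) x)| <= lambda) :
  exists r eps Lambda : R,
    [/\ 0 < r, 0 < eps, 0 < Lambda < 1 &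
      forall mu : 'I_N -> probability (circle R) R,
        supp_size mu < eps -> msupportN mu `<=` torus_nbh r X ->
        exists2 C : R, 0 < C &
          forall n, (wasserstein_set (iter n (sc_transfer f h) mu)
                       (dirac_tuples X) <= (C * Lambda ^+ n)%:E)%E].
Proof.
have msupportN_nonempty (mu : 'I_N -> probability (circle R) R) :
    msupportN mu !=set0.
  have /choice[x hx] := fun i => msupport_nonempty (mu i).
  by exists (\row_i x i) => i; rewrite mxE; exact: hx.
have nbh_nonempty mu r : msupportN mu `<=` torus_nbh r X -> X !=set0.
  move=> muX; have [x /muX] := msupportN_nonempty mu.
  by move=> /ereal_inf_lt[_ [y Xy _] _]; exists y.
have half_itv : 0 < (2^-1 : R) < 1 by apply/andP; split; lra.
(* For empty [X] no tuple satisfies the hypothesis on supports, because supports are nonempty. *)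
have [X0|X0] := pselect (X !=set0); last first.
  by exists 1, 1, 2^-1; split=> // mu _ /nbh_nonempty.
(* For [N = 0] all distances are empty maxima, hence 0, and [hg] says nothing about [n0]. *)
have [N0|N0] := posnP N.
  have noI (i : 'I_N) : False by case: i => i; rewrite N0.
  exists 1, 1, 2^-1; split=> // mu _ _; exists 1 => // n.
  have [x Xx] := X0; pose dx i := dirac (x 0 i) : probability (circle R) R.
  apply: (@le_trans _ _ (wassersteinN (iter n (sc_transfer f h) mu) dx)).
    by apply: ereal_inf_lbound; exists dx => //; exists x.
  apply: bigmax_le => [|i _]; last by case: (noI i).
  by rewrite lee_fin mul1r exprn_ge0// invr_ge0.
(* For [n0 = 0] the product in [hg] would be empty, hence 1, which exceeds [lambda]. *)
have n00 : (0 < n0)%N.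
  rewrite lt0n; apply/negP => /eqP n00; have [x Xx] := X0.
  have := hg x Xx (Ordinal N0).
  by rewrite n00 big_geq// normr1; lra.
have [U [oU XU GU attr]] := hXattr.
have [rU rU0 XrU] := closure_nbh oU XU.
have [K [f1 [h1 [K1 fK hK]]]] := uniform_bounds hf hh.
have XG x : X x -> X (G_map f h x) by move=> Xx; apply: hXinv; exists x.
have sc_cont nu i : continuous (sc_map f h nu i).
  exact: (@sc_map_continuous _ _ _ _ _ _ _ K1 fK hK).
have [r [eps [Lambda [r0 eps0 Lambda01 conv]]]] :=
  exponential_convergence (step_const_ge1 K1)
    (fun nu z rho i y => @step_close _ _ _ _ _ _ _ K1 fK hK nu z rho i y)
    sc_cont (G_map_lipschitz K1 fK hK) (g_fun_le K1 fK hK)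
    (fun nu z rho i y y' =>
       @step_contraction _ _ _ _ _ _ _ K1 fK hK nu z rho i y y')
    X0 hlambda XG rU0 XrU attr hg n00.
exists r, eps, Lambda; split=> // mu mu_eps muX.
(* Any point of the product support serves as the initial centre. *)
have [x sx] := msupportN_nonempty mu.
apply: (conv mu x).
  move=> i; apply: msupport_cball (sx i).
  apply: le_lt_trans mu_eps.
  exact: (le_bigmax _ (fun i => arc_hull_length (msupport (mu i)))).
by rewrite -lte_fin -torus_dist_setE//; exact: muX.
Qed.
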